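(* Let $(M,C)$ be a contact manifold and $(P,\omega)$ its symplectic cover, with projection $\tau:P\to M$. Any Riemannian metric $g_M$ on $M$ determines a unique calibration $\mathfrak{s}$ on $P$ (the $g_M$-calibration), and thus a submanifold $\tilde M$ of $P$ defined as the zero locus of the function $\mathfrak{s}-1$. This submanifold is a 2-sheeted cover of $M$ with respect to $\tau$, and the multiplication $h_{-1}$ by $-1$ in $P$ induces a canonical diffeomorphism $\sigma:\tilde M\to\tilde M$ interchanging the two local sheets. The restriction $\tilde\eta$ of the Liouville 1-form $\vartheta=i_\nabla\omega$ to $\tilde M$ is a contact form on $\tilde M$ satisfying $\sigma^*(\tilde\eta)=-\tilde\eta$, whose contact distribution $\tilde C=\ker\tilde\eta$ is the pullback of $C$: $T\tau(\tilde C)=C$.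
   Context: A contact manifold $(M,C)$ is a manifold of odd dimension $2n+1$ with a corank-one distribution $C\subset TM$ which is locally the kernel of a contact form, i.e. a 1-form $\eta$ with $\eta\wedge(\mathrm{d}\eta)^n\neq0$. A symplectic $\mathbb{R}^\times$-bundle is a principal bundle $\tau:P\to M$ with group $\mathbb{R}^\times$ (nonzero reals under multiplication), action $s\mapsto h_s$, and a symplectic form $\omega$ with $h_s^*\omega=s\,\omega$ for all $s\in\mathbb{R}^\times$; $\nabla$ is the infinitesimal generator of the action ($\nabla=s\partial_s$ in local trivializations) and $\vartheta=i_\nabla\omega$. It is a symplectic cover of $(M,C)$ if $C=T\tau(\ker\vartheta)$; it exists and is unique up to isomorphism. The form $\vartheta$ is semibasic, so each $p\in P_x$ determines a covector $\Phi(p)\in T_x^*M$ with $\vartheta_p=\tau^*(\Phi(p))$; $\Phi$ identifies $P$ with the annihilator of $C$ in $T^*M$ with the zero section removed. A calibration on $P$ is a smooth function $\mathfrak{s}:P\to\mathbb{R}$, $\mathfrak{s}>0$, with $\mathfrak{s}(h_t(p))=t\,\mathfrak{s}(p)$ for $t>0$ and invariant under $h_{-1}$, i.e. $\mathfrak{s}(h_t(p))=|t|\,\mathfrak{s}(p)$ for all $t\in\mathbb{R}^\times$. The $g_M$-calibration is $\mathfrak{s}(p)=|\Phi(p)(v)|/\|v\|$ for $p\in P_x$, where $v$ is any nonzero vector of the $g_M$-orthogonal complement of $C_x$ and $\|v\|=\sqrt{g_M(v,v)}$. *)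

(* Defs.v *)
From HB Require Import structures.
From mathcomp Require Import all_boot all_order all_algebra all_fingroup.
From mathcomp Require Import all_classical all_reals all_analysis.

Set Implicit Arguments.
Unset Strict Implicit.
Unset Printing Implicit Defensive.

Import Order.TTheory GRing.Theory Num.Theory.
Import numFieldNormedType.Exports.

Local Open Scope classical_set_scope.
Local Open Scope ring_scope.

Section EuclideanSmooth.
Variables (R : realType) (d : nat) (W : normedModType R).

(* [g] is C^k on [U], for [U] open. *)
Fixpoint Ck (k : nat) (U : set 'rV[R]_d) (g : 'rV[R]_d -> W) : Prop :=
  match k with
  | 0 => forall y, U y -> {for y, continuous g}
  | k'.+1 => (forall y, U y -> differentiable g y) /\
             forall v : 'rV[R]_d, Ck k' U (fun y => 'D_v g y)
  end.

Definition Cinf_at (g : 'rV[R]_d -> W) (y : 'rV[R]_d) : Prop :=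
  forall k, exists U, [/\ open U, U y & Ck k U g].

End EuclideanSmooth.

(* An atlas is given as a family of charts indexed by the points of the space,
   [chart_at x] being a chart around [x].  The tangent space at [x] is the
   coordinate space ['rV[R]_d], a tangent vector being identified with its
   components in the chart [chart_at x].  [charted] is bare data; the axioms
   are in [smooth_manifold]. *)

Record chart (R : realType) (T : topologicalType) (d : nat) := Chart {
  cdom : set T;
  cmap : T -> 'rV[R]_d;
  cinv : 'rV[R]_d -> T }.

(* Outside [cdom] (resp. its image) the values of [cmap] (resp. [cinv]) are
   irrelevant. *)
Definition is_chart (R : realType) (T : topologicalType) (d : nat)
    (c : chart R T d) : Prop :=
  [/\ open (cdom c),
      open (cmap c @` cdom c),
      forall x, cdom c x -> {for x, continuous (cmap c)},
      forall y, (cmap c @` cdom c) y -> {for y, continuous (cinv c)}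
    & forall x, cdom c x -> cinv c (cmap c x) = x].

Record charted (R : realType) (d : nat) := Charted {
  pt :> topologicalType;
  chart_at : pt -> chart R pt d }.

Section Manifold.
Variables (R : realType) (d : nat) (M : charted R d).

Definition smooth_manifold : Prop :=
  [/\ hausdorff_space M,
      @second_countable M,
      forall x : M, is_chart (chart_at x) /\ cdom (chart_at x) x
    & forall x x' z : M, cdom (chart_at x) z -> cdom (chart_at x') z ->
      Cinf_at (cmap (chart_at x') \o cinv (chart_at x)) (cmap (chart_at x) z)].

Definition coord (x : M) : 'rV[R]_d := cmap (chart_at x) x.

End Manifold.

Definition real_line (R : realType) : charted R 1 :=
  @Charted R 1 R (fun=> Chart setT (fun t : R => const_mx t)
                                   (fun y : 'rV[R]_1 => y ord0 ord0)).

Definition prod_charted (R : realType) (d e : nat)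
    (M : charted R d) (N : charted R e) : charted R (d + e) :=
  @Charted R (d + e) (M * N)%type (fun z =>
    let a := chart_at z.1 in let b := chart_at z.2 in
    Chart (cdom a `*` cdom b)
          (fun w : M * N => row_mx (cmap a w.1) (cmap b w.2))
          (fun y => (cinv a (lsubmx y), cinv b (rsubmx y)))).

Section SmoothMaps.
Variables (R : realType) (d e : nat) (M : charted R d) (N : charted R e).

Definition local_expr (f : M -> N) (x : M) : 'rV[R]_d -> 'rV[R]_e :=
  cmap (chart_at (f x)) \o f \o cinv (chart_at x).

Definition smooth_at (f : M -> N) (x : M) : Prop :=
  {for x, continuous f} /\ Cinf_at (local_expr f x) (coord x).

Definition smooth_on (A : set M) (f : M -> N) : Prop :=
  forall x, A x -> smooth_at f x.

Definition tangent_map (f : M -> N) (x : M) : 'rV[R]_d -> 'rV[R]_e :=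
  'd (local_expr f x) (coord x).

End SmoothMaps.

Definition diffeo_on (R : realType) (d e : nat)
    (M : charted R d) (N : charted R e) (A : set M) (B : set N)
    (f : M -> N) (g : N -> M) : Prop :=
  [/\ smooth_on A f, smooth_on B g,
      forall x, A x -> B (f x) /\ g (f x) = x
    & forall y, B y -> A (g y) /\ f (g y) = y].

(* The structure [ch] on the topological subspace [S] of [P] makes it an
   embedded submanifold: the inclusion is a smooth immersion. *)
Definition embedded_submanifold (R : realType) (d e : nat) (P : charted R e)
    (S : set P) (ch : set_type S -> chart R (set_type S) d) : Prop :=
  let N := Charted ch in
  let incl : N -> P := set_val in
  [/\ smooth_manifold N, smooth_on setT incl
    & forall q : N, injective (tangent_map incl q)].

(* The open set [U] is evenly covered by the two sheets [V true], [V false]. *)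
Definition two_sheets (R : realType) (d : nat) (N M : charted R d)
    (f : N -> M) (U : set M) (V : bool -> set N) : Prop :=
  [/\ open U, forall b, open (V b), V true `&` V false = set0,
      f @^-1` U = V true `|` V false
    & forall b, exists g, diffeo_on (V b) U f g].

Definition two_sheeted_cover (R : realType) (d : nat) (N M : charted R d)
    (f : N -> M) : Prop :=
  smooth_on setT f /\ forall x, exists U V, U x /\ two_sheets f U V.

Definition tensor (R : realType) (d k : nat) := ('I_k -> 'rV[R]_d) -> R.

Section LinearForms.
Variables (R : realType) (d : nat).

Definition multilinear (k : nat) (a : tensor R d k) : Prop :=
  forall (i : 'I_k) (v : 'I_k -> 'rV[R]_d) (c : R) (u w : 'rV[R]_d),
    let upd z := fun j => if j == i then z else v j in
    a (upd (c *: u + w)) = c * a (upd u) + a (upd w).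

Definition alternating (k : nat) (a : tensor R d k) : Prop :=
  forall (v : 'I_k -> 'rV[R]_d) (i j : 'I_k), i != j -> v i = v j -> a v = 0.

Definition pair_of (u v : 'rV[R]_d) : 'I_2 -> 'rV[R]_d :=
  fun i => if i == ord0 then u else v.

Definition wedge (k l : nat) (a : tensor R d k) (b : tensor R d l) :
    tensor R d (k + l) :=
  fun v => (k`! * l`!)%:R^-1 *
    \sum_(s : 'S_(k + l)) (-1) ^+ s *
       a (fun i => v (s (lshift l i))) * b (fun j => v (s (rshift k j))).

Fixpoint wedge_exp (b : tensor R d 2) (n : nat) : tensor R d n.*2 :=
  match n with
  | 0 => fun=> 1
  | n'.+1 => wedge b (@wedge_exp b n')
  end.

End LinearForms.

Arguments wedge_exp {R d} b n _.

Definition tensor_field (R : realType) (d : nat) (M : charted R d) (k : nat) :=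
  M -> tensor R d k.

Section Forms.
Variables (R : realType) (d : nat) (M : charted R d).

(* The expression of [a] in the chart at [x]: its value at the point of
   coordinates [y] is the pullback by [cinv (chart_at x)]. *)
Definition local_tensor (k : nat) (a : tensor_field M k) (x : M)
    (y : 'rV[R]_d) : tensor R d k :=
  let c := chart_at x in
  let z := cinv c y in
  fun v => a z (fun i => 'd (cmap (chart_at z) \o cinv c) y (v i)).

(* The functions [fun y => local_tensor a x y v], for [v] constant, are the
   linear combinations of the components of [a] in the chart at [x]. *)
Definition smooth_tensor_on (k : nat) (A : set M) (a : tensor_field M k) :
    Prop :=
  forall x, A x -> multilinear (a x) /\
    forall v, Cinf_at (fun y => local_tensor a x y v : R) (coord x).

Definition form_on (k : nat) (A : set M) (a : tensor_field M k) : Prop :=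
  smooth_tensor_on A a /\ forall x, A x -> alternating (a x).

(* The value at [x] is computed in the chart at [x]; for a 1-form this is the
   convention da(X,Y) = X(a(Y)) - Y(a(X)) - a([X,Y]). *)
Definition ext_deriv (k : nat) (a : tensor_field M k) : tensor_field M k.+1 :=
  fun x v => \sum_(i < k.+1) (-1) ^+ i *
    'D_(v i) (fun y => local_tensor a x y (fun j => v (lift i j)) : R)
      (coord x).

Definition contract (X : M -> 'rV[R]_d) (k : nat) (a : tensor_field M k.+1) :
    tensor_field M k :=
  fun x v => a x (fun i => if unlift ord0 i is Some j then v j else X x).

Definition kernel1 (a : tensor_field M 1) (x : M) : set 'rV[R]_d :=
  [set v | a x (fun=> v) = 0].

Definition riemannian (g : tensor_field M 2) : Prop :=
  [/\ smooth_tensor_on setT g,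
      forall x u v, g x (pair_of u v) = g x (pair_of v u)
    & forall x v, v != 0 -> 0 < g x (pair_of v v)].

Definition symplectic (w : tensor_field M 2) : Prop :=
  [/\ form_on setT w, forall x v, ext_deriv w x v = 0
    & forall x u, (forall v, w x (pair_of u v) = 0) -> u = 0].

End Forms.

Definition pullback (R : realType) (d e : nat)
    (M : charted R d) (N : charted R e) (f : M -> N) (k : nat)
    (a : tensor_field N k) : tensor_field M k :=
  fun x v => a (f x) (fun i => tangent_map f x (v i)).

(* The image under [T f] of a family of tangent vectors [E] (a subset of the
   tangent bundle). *)
Definition tangent_image (R : realType) (d e : nat)
    (M : charted R d) (N : charted R e) (f : M -> N)
    (E : M -> set 'rV[R]_d) (y : N) : set 'rV[R]_e :=
  [set w | exists x, f x = y /\ (tangent_map f x @` E x) w].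

Section Contact.
Variables (R : realType) (n : nat) (M : charted R n.*2.+1).

Definition contact_form_on (U : set M) (eta : tensor_field M 1) : Prop :=
  form_on U eta /\
  forall x, U x ->
    exists v, wedge (eta x) (wedge_exp (ext_deriv eta x) n) v != 0.

Definition contact_manifold (C : M -> {vspace 'rV[R]_(n.*2.+1)}) : Prop :=
  [/\ smooth_manifold M, forall x, \dim (C x) = n.*2
    & forall x, exists U eta, [/\ open U, U x, contact_form_on U eta
      & forall y, U y -> kernel1 eta y = [set v | v \in C y]]].

End Contact.

(* The group of nonzero reals acts through [h : R -> P -> P]; the values
   [h 0 p] are irrelevant. *)

Section Bundle.
Variables (R : realType) (m e : nat) (M : charted R m) (P : charted R e).
Variables (tau : P -> M) (h : R -> P -> P).

Definition punctured : set R := [set s | s != 0].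

Definition principal_bundle : Prop :=
  [/\ [/\ smooth_manifold P, smooth_manifold M & smooth_on setT tau],
      [/\ smooth_on (M := prod_charted (real_line R) P) (punctured `*` setT)
            (fun z => h z.1 z.2),
          forall p, h 1 p = p
        & forall s t p, s != 0 -> t != 0 -> h s (h t p) = h (s * t) p],
      forall s p, s != 0 -> tau (h s p) = tau p
    & forall x, exists (U : set M)
        (psi : P -> M * R) (psi' : M * R -> P),
      [/\ open U, U x,
          diffeo_on (N := prod_charted M (real_line R))
            (tau @^-1` U) (U `*` punctured) psi psi',
          forall p, U (tau p) -> (psi p).1 = tau p
        & forall s p, s != 0 -> U (tau p) -> (psi (h s p)).2 = s * (psi p).2]].

(* The infinitesimal generator, d/ds (h s p) at s = 1. *)
Definition generator (p : P) : 'rV[R]_e :=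
  tangent_map (M := real_line R) (fun s : R => h s p) 1 (const_mx 1).

Definition symplectic_bundle (w : tensor_field P 2) : Prop :=
  [/\ principal_bundle, symplectic w
    & forall s, s != 0 -> forall p v, pullback (h s) w p v = s * w p v].

Definition liouville (w : tensor_field P 2) : tensor_field P 1 :=
  contract generator w.

Definition symplectic_cover (C : M -> {vspace 'rV[R]_m})
    (w : tensor_field P 2) : Prop :=
  symplectic_bundle w /\
  forall x, tangent_image tau (kernel1 (liouville w)) x = [set v | v \in C x].

(* [xi] is the covector Phi(p) on the base. *)
Definition is_Phi (w : tensor_field P 2) (p : P) (xi : {scalar 'rV[R]_m}) :
    Prop :=
  forall v, liouville w p (fun=> v) = xi (tangent_map tau p v).

Definition calibration (s : P -> R) : Prop :=
  [/\ smooth_on (N := real_line R) setT s, forall p, 0 < s p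
    & forall t p, t != 0 -> s (h t p) = `|t| * s p].

Definition metric_calibration (C : M -> {vspace 'rV[R]_m})
    (w : tensor_field P 2) (g : tensor_field M 2) (s : P -> R) : Prop :=
  forall p, exists2 xi, is_Phi w p xi &
    forall v, v != 0 ->
      (forall u, u \in C (tau p) -> g (tau p) (pair_of v u) = 0) ->
      s p = `|xi v| / Num.sqrt (g (tau p) (pair_of v v)).

End Bundle.

(* Main.v *)
(* A trivialization of [P] over an open set gives a local section [sg] and a fibre
   coordinate [rho] with [p = h (rho p) (sg (tau p))], so [T tau] is onto with
   kernel spanned by the generator, where [theta = i_nabla omega] vanishes; hence
   [theta_p] factors through a covector [Phi p] of the base, and [ker (Phi p) = C]
   by dimension count.  The calibration is the norm of [Phi p] for the metric dual
   to [gM].  Its smoothness is seen by writing [Phi p = lam p * eta (tau p)] with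
   [eta] a local contact form: [lam] is a quotient of smooth functions, and the
   norm of [eta] involves only the inverse of the Gram matrix of [gM].

   Rescaling [sg] so that the calibration is [1] on it, the unit level set over the
   domain of [sg] is the disjoint union of the images of [sg] and [h (-1) sg].  The
   charts of the base, composed with the projection, are therefore charts of the
   level set, no implicit function theorem being needed; in these charts the
   projection and the flip are the identity, and the restriction of [theta] is
   [lam * eta].  As [d(lam eta) = lam d eta + d lam /\ eta], it is a contact form:
   evaluate [eta /\ (d eta)^n] on vectors all but one of which lie in [ker eta]. *)

Require Import Defs.
From HB Require Import structures.
From mathcomp Require Import all_boot all_order all_algebra all_fingroup.
From mathcomp Require Import all_classical all_reals all_analysis.
From mathcomp Require Import ring.

Set Implicit Arguments.
Unset Strict Implicit.
Unset Printing Implicit Defensive.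

Import Order.TTheory GRing.Theory Num.Theory.
Import numFieldNormedType.Exports.

Local Open Scope classical_set_scope.
Local Open Scope ring_scope.

Local Notation coord := Defs.coord.

(** * Calculus on coordinate spaces *)

(** Each tangent space is the coordinate space of the chart indexed by its point, and [chart_at] may
    jump from one point to the next, so the components of a smooth tensor or of a tangent map need
    not even vary continuously. Smoothness can only be read in one fixed chart, and every pointwise
    identity has to be carried there: this is the task of [transition] and [tangent_map_transition].
    On the level set the same feature becomes an advantage: giving a point the base chart indexed by
    its projection makes its tangent space literally that of the base point. Two smoothness facts
    are hidden by their definitions. The generator is a velocity computed point by point; it is
    smooth as a partial derivative of the joint action. The factor [lam] is built from vectors
    chosen without regularity; it is smooth because near each point it equals a quotient evaluated
    on one constant coordinate vector. *)

Lemma continuous_near_open (S T : topologicalType) (f : S -> T) x (B : set T) :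
  {for x, continuous f} -> open B -> B (f x) -> \forall z \near x, B (f z).
Proof.
move=> cf oB Bfx; have := cf B; apply.
exact: open_nbhs_nbhs.
Qed.

Section Germs.
Variables (R : realType) (V W : normedModType R).
Implicit Types (f g : V -> W).

Lemma near_eq_diff_subproof f g x : {near x, f =1 g} -> differentiable f x ->
  g \o shift x = cst (g x) + 'd f x +o_ 0 id.
Proof.
move=> fg df; apply/eqaddoP => e e0.
have /eqaddoP/(_ _ e0) := diff_locally df.
have fg0 : \forall z \near (0 : V), f (z + x) = g (z + x).
  have : \forall z \near x, f z = g z by exact: fg.
  by rewrite (near_shift 0) subr0.
apply: filterS2 fg0 => z /= fgz.
by rewrite !fctE /= fgz (nbhs_singleton fg).
Qed.

Lemma near_eq_diff f g x : {near x, f =1 g} -> differentiable f x ->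
  'd g x = 'd f x :> (V -> W).
Proof.
move=> fg df; apply: diff_unique; last exact: near_eq_diff_subproof.
exact: diff_continuous.
Qed.

Lemma near_eq_differentiable f g x : {near x, f =1 g} ->
  differentiable f x -> differentiable g x.
Proof.
move=> fg df; apply/diff_locallyP; rewrite (near_eq_diff fg df).
by split; [exact: diff_continuous | exact: near_eq_diff_subproof].
Qed.

End Germs.

Section CkGeneral.
Variables (R : realType) (d : nat) (W : normedModType R).
Implicit Types (f g : 'rV[R]_d -> W) (U A : set 'rV[R]_d).

Lemma Ck_subset k U A f : A `<=` U -> Ck k U f -> Ck k A f.
Proof.
move=> AU; elim: k f => [|k IH] f /= => [cf y /AU|[df cf]]; first exact: cf.
by split=> [y /AU|v]; [exact: df | exact: IH].
Qed.

(** Openness of [U] turns agreement on [U] into agreement of germs at its points, which is all that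
    continuity and derivatives see. *)
Lemma Ck_eq k U f g : open U -> (forall y, U y -> f y = g y) ->
  Ck k U f -> Ck k U g.
Proof.
move=> oU; elim: k f g => [|k IH] f g fg /= => [cf y Uy|[df cf]].
  have nfg : \forall z \near y, f z = g z.
    by apply: filterS (open_nbhs_nbhs (conj oU Uy)); exact: fg.
  rewrite /prop_for /continuous_at -(fg _ Uy).
  exact: cvg_trans (near_eq_cvg nfg) (cf _ Uy).
have nfg y (Uy : U y) : {near y, f =1 g}.
  by apply: filterS (open_nbhs_nbhs (conj oU Uy)); exact: fg.
split=> [y Uy|v]; first exact: near_eq_differentiable (nfg _ Uy) (df _ Uy).
apply: IH (cf v) => y Uy; apply: near_eq_derive; exact: nfg.
Qed.

Lemma CkW k U f : Ck k.+1 U f -> Ck k U f.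
Proof.
elim: k f => [|k IH] f [df cf]; first by move=> y /df/differentiable_continuous.
by split=> // v; exact: IH.
Qed.

Lemma Ck_cst k U (a : W) : Ck k U (cst a).
Proof.
elim: k a => [|k IH] a /=; first by move=> y _; exact: cst_continuous.
split=> [y _|v]; first exact: differentiable_cst.
rewrite (_ : (fun _ => _) = cst 0); first exact: IH.
by apply/funext => y; rewrite derive_cst.
Qed.

Lemma CkD k U f g : open U -> Ck k U f -> Ck k U g ->
  Ck k U (fun y => f y + g y).
Proof.
move=> oU; elim: k f g => [|k IH] f g.
  by move=> cf cg y Uy; apply: continuousD; [exact: cf | exact: cg].
move=> [df cf] [dg cg]; split=> [y Uy|v].
  by apply: differentiableD; [exact: df | exact: dg].
apply: Ck_eq (IH _ _ (cf v) (cg v)) => // y Uy.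
by rewrite -deriveD //; apply: diff_derivable; [exact: df | exact: dg].
Qed.

(** The open set in [Cinf_at] may shrink with the order [k]. Quantifying over the open subsets of an
    arbitrary neighbourhood lets two functions be combined by intersecting their neighbourhoods. *)
Lemma Cinf_atP f y : (forall k, exists2 A, nbhs y A &
    forall U, open U -> U `<=` A -> Ck k U f) -> Cinf_at f y.
Proof.
move=> H k; have [A nA HA] := H k.
exists (interior A); split; [exact: open_interior | exact: nA |].
by apply: HA; [exact: open_interior | exact: interior_subset].
Qed.

Lemma Cinf_at_Ck f y k : Cinf_at f y ->
  exists2 A, nbhs y A & forall U, open U -> U `<=` A -> Ck k U f.
Proof.
move=> /(_ k) [A [oA Ay cA]]; exists A; first exact: open_nbhs_nbhs.
by move=> U _ UA; exact: Ck_subset cA.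
Qed.

Lemma Cinf_at_near f y : Cinf_at f y -> \forall z \near y, differentiable f z.
Proof.
move=> /(_ 1) [A [oA Ay [df _]]].
by apply: filterS (open_nbhs_nbhs (conj oA Ay)).
Qed.

Lemma Cinf_at_diff f y : Cinf_at f y -> differentiable f y.
Proof. by move/Cinf_at_near/nbhs_singleton. Qed.

Lemma Cinf_at_continuous f y : Cinf_at f y -> {for y, continuous f}.
Proof. by move/Cinf_at_diff/differentiable_continuous. Qed.

Lemma Cinf_at_derive f y v : Cinf_at f y -> Cinf_at (fun z => 'D_v f z) y.
Proof. by move=> H k; have [A [oA Ay [_ /(_ v) cf]]] := H k.+1; exists A. Qed.

Lemma near_eq_Cinf_at f g y : {near y, f =1 g} -> Cinf_at f y -> Cinf_at g y.
Proof.
move=> fg H; apply: Cinf_atP => k; have [A nA cA] := Cinf_at_Ck k H.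
exists (A `&` [set z | f z = g z]); first exact: filterI.
move=> U oU UA; apply: Ck_eq (cA U oU _) => // z /UA []//.
Qed.

Lemma eq_Cinf_at f g y : f =1 g -> Cinf_at f y -> Cinf_at g y.
Proof. by move=> /funext ->. Qed.

Lemma Cinf_at_cst (y : 'rV[R]_d) (a : W) : Cinf_at (fun=> a) y.
Proof. by move=> k; exists setT; split=> //; [exact: openT | exact: Ck_cst]. Qed.

Lemma Cinf_atD f g y : Cinf_at f y -> Cinf_at g y ->
  Cinf_at (fun z => f z + g z) y.
Proof.
move=> Hf Hg; apply: Cinf_atP => k.
have [A nA cA] := Cinf_at_Ck k Hf; have [B nB cB] := Cinf_at_Ck k Hg.
exists (A `&` B); first exact: filterI.
by move=> U oU UAB; apply: CkD => //; [apply: cA|apply: cB] => // z /UAB[].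
Qed.

Lemma Cinf_at_sum (I : Type) (r : seq I) (P : pred I)
    (f : I -> 'rV[R]_d -> W) y :
  (forall i, Cinf_at (f i) y) ->
  Cinf_at (fun z => \sum_(i <- r | P i) f i z) y.
Proof.
move=> H; elim: r => [|i r IH].
  by apply: eq_Cinf_at (Cinf_at_cst _ _) => z; rewrite big_nil.
case Pi: (P i).
  by apply: eq_Cinf_at (Cinf_atD (H i) IH) => z; rewrite big_cons Pi.
by apply: eq_Cinf_at IH => z; rewrite big_cons Pi.
Qed.

End CkGeneral.

Section CkReal.
Variables (R : realType) (d : nat).
Implicit Types (f g : 'rV[R]_d -> R) (U A : set 'rV[R]_d).

Lemma CkM k U f g : open U -> Ck k U f -> Ck k U g ->
  Ck k U (fun y => f y * g y).
Proof.
move=> oU; elim: k f g => [|k IH] f g.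
  by move=> cf cg y Uy; apply: continuousM; [exact: cf | exact: cg].
move=> Cf Cg; have [[df cf] [dg cg]] := (Cf, Cg).
split=> [y Uy|v]; first by apply: differentiableM; [exact: df | exact: dg].
apply: (@Ck_eq _ _ _ _ _ (fun y => f y * 'D_v g y + g y * 'D_v f y)) => //.
  move=> y Uy; rewrite -[RHS]/('D_v (f * g) y) deriveM //.
    exact/diff_derivable/df.
  exact/diff_derivable/dg.
by apply: CkD => //; apply: IH; do ?[exact: CkW | exact: cf | exact: cg].
Qed.

(** The derivative of [1 / f] is a product of copies of [1 / f] and a derivative of [f], so the
    induction on [k] closes. [Ck_sqrt] follows the same pattern. *)
Lemma CkV k U f : open U -> (forall y, U y -> f y != 0) -> Ck k U f ->
  Ck k U (fun y => (f y)^-1).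
Proof.
move=> oU f0; elim: k => [|k IH].
  by move=> cf y Uy; apply: continuousV; [exact: f0 | exact: cf].
move=> Cf; have [df cf] := Cf.
split=> [y Uy|v]; first by apply: differentiableV; [exact: df | exact: f0].
have IHf := IH (CkW Cf).
apply: (@Ck_eq _ _ _ _ _
  (fun y => (-1) * ((f y)^-1 * ((f y)^-1 * 'D_v f y)))) => //.
  move=> y Uy; rewrite deriveV //; [|exact: f0|exact/diff_derivable/df].
  by rewrite /GRing.scale /= expr2 invfM mulN1r mulNr !mulrA.
apply: CkM => //; first exact: Ck_cst.
by do 2![apply: CkM => //]; exact: cf.
Qed.

Lemma Ck_sqrt k U f : open U -> (forall y, U y -> 0 < f y) -> Ck k U f ->
  Ck k U (fun y => Num.sqrt (f y)).
Proof.
move=> oU f0; elim: k => [|k IH].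
  move=> cf y Uy; apply: continuous_comp; first exact: cf.
  exact: sqrt_continuous.
move=> Cf; have [df cf] := Cf.
have dsq y (Uy : U y) : differentiable Num.sqrt (f y).
  by apply/derivable1_diffP; have [] := is_derive1_sqrt (f0 _ Uy).
split=> [y Uy|v].
  by apply: differentiable_comp; [exact: df|exact: dsq].
have IHf := IH (CkW Cf).
apply: (@Ck_eq _ _ _ _ _ (fun y => (2 * Num.sqrt (f y))^-1 * 'D_v f y)) => //.
  move=> y Uy.
  have dsf : differentiable (Num.sqrt \o f) y.
    by apply: differentiable_comp; [exact: df|exact: dsq].
  rewrite -[RHS]/('D_v (Num.sqrt \o f) y) [RHS](deriveE _ dsf).
  rewrite (diff_comp (df _ Uy) (dsq _ Uy)) /= (deriveE _ (df _ Uy)).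
  rewrite (diff1E (dsq _ Uy)) /GRing.scale /= mulrC.
  have [_ dv] := is_derive1_sqrt (f0 _ Uy).
  by rewrite derive1E dv.
apply: CkM => //; last exact: cf.
apply: CkV => //.
  by move=> y Uy; rewrite mulf_neq0 ?pnatr_eq0 // gt_eqF // sqrtr_gt0; exact: f0.
by apply: CkM => //; exact: Ck_cst.
Qed.

Lemma Ck_coord k U (i : 'I_d) : Ck k U (fun y : 'rV[R]_d => y 0 i : R).
Proof.
case: k => [|k] /=; first by move=> y _; exact: coord_continuous.
split=> [y _|v]; first exact: differentiable_coord.
rewrite (_ : (fun _ => _) = cst (v 0 i)); first exact: Ck_cst.
apply/funext => y; rewrite deriveE; last exact: differentiable_coord.
have @f : {linear 'rV[R]_d -> R}.
  by exists (fun N : 'rV[R]_d => N 0 i); do 2![eexists]; do ?[constructor];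
     rewrite ?mxE// => ? *; rewrite ?mxE//; move=> ?; rewrite !mxE.
by rewrite (@diff_lin _ _ _ f) //; exact: coord_continuous.
Qed.

Lemma Cinf_atM f g y : Cinf_at f y -> Cinf_at g y ->
  Cinf_at (fun z => f z * g z) y.
Proof.
move=> Hf Hg; apply: Cinf_atP => k.
have [A nA cA] := Cinf_at_Ck k Hf; have [B nB cB] := Cinf_at_Ck k Hg.
exists (A `&` B); first exact: filterI.
by move=> U oU UAB; apply: CkM => //; [apply: cA|apply: cB] => // z /UAB[].
Qed.

Lemma Cinf_at_prod (I : Type) (r : seq I) (P : pred I)
    (f : I -> 'rV[R]_d -> R) y :
  (forall i, Cinf_at (f i) y) ->
  Cinf_at (fun z => \prod_(i <- r | P i) f i z) y.
Proof.
move=> H; elim: r => [|i r IH].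
  by apply: eq_Cinf_at (Cinf_at_cst _ _) => z; rewrite big_nil.
case Pi: (P i).
  by apply: eq_Cinf_at (Cinf_atM (H i) IH) => z /=; rewrite big_cons Pi.
by apply: eq_Cinf_at IH => z; rewrite big_cons Pi.
Qed.

Lemma Cinf_atV f y : f y != 0 -> Cinf_at f y -> Cinf_at (fun z => (f z)^-1) y.
Proof.
move=> fy0 Hf; apply: Cinf_atP => k; have [A nA cA] := Cinf_at_Ck k Hf.
exists (A `&` [set z | f z != 0]).
  apply: filterI => //.
  exact: (continuous_near_open (Cinf_at_continuous Hf) (@open_neq R 0) fy0).
by move=> U oU UA; apply: CkV => //; [|apply: cA => //] => z /UA[].
Qed.

Lemma Cinf_at_sqrt f y : 0 < f y -> Cinf_at f y ->
  Cinf_at (fun z => Num.sqrt (f z)) y.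
Proof.
move=> fy0 Hf; apply: Cinf_atP => k; have [A nA cA] := Cinf_at_Ck k Hf.
exists (A `&` [set z | 0 < f z]).
  apply: filterI => //.
  exact: (continuous_near_open (Cinf_at_continuous Hf) (@open_gt R 0) fy0).
by move=> U oU UA; apply: Ck_sqrt => //; [|apply: cA => //] => z /UA[].
Qed.

Lemma Cinf_at_coord (y : 'rV[R]_d) (i : 'I_d) : Cinf_at (fun z : 'rV[R]_d => z 0 i : R) y.
Proof. by move=> k; exists setT; split=> //; [exact: openT | exact: Ck_coord]. Qed.

End CkReal.

Lemma diff_rV_sum (R : realType) (e : nat) (g : 'rV[R]_e -> R) z w :
  differentiable g z -> 'd g z w = \sum_(i < e) w 0 i * 'D_(delta_mx 0 i) g z.
Proof.
move=> dg; rewrite {1}(row_sum_delta w) linear_sum.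
by apply: eq_bigr => i _; rewrite linearZ deriveE.
Qed.

Section CkVector.
Variables (R : realType) (d e : nat).
Implicit Types (f : 'rV[R]_d -> 'rV[R]_e) (U : set 'rV[R]_d).

Lemma diff_coord (y : 'rV[R]_e) i v : 'd (fun z : 'rV[R]_e => z 0 i : R) y v = v 0 i.
Proof.
have @f : {linear 'rV[R]_e -> R}.
  by exists (fun N : 'rV[R]_e => N 0 i); do 2![eexists]; do ?[constructor];
     rewrite ?mxE// => ? *; rewrite ?mxE//; move=> ?; rewrite !mxE.
by rewrite (@diff_lin _ _ _ f) //; exact: coord_continuous.
Qed.

Lemma differentiable_coordf f y i : differentiable f y ->
  differentiable (fun z => f z 0 i : R) y.
Proof.
move=> df; apply: (@differentiable_comp _ _ _ _ f (fun z : 'rV[R]_e => z 0 i)) => //.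
exact: differentiable_coord.
Qed.

Lemma derive_coordf f y v i : differentiable f y ->
  'D_v (fun z => f z 0 i : R) y = ('D_v f y) 0 i.
Proof.
move=> df; rewrite deriveE; last exact: differentiable_coordf.
rewrite (@diff_comp _ _ _ _ f (fun z : 'rV[R]_e => z 0 i)) //; last first.
  exact: differentiable_coord.
by rewrite /= diff_coord -deriveE.
Qed.

Lemma differentiable_rowP f y :
  differentiable f y <-> forall i, differentiable (fun z => f z 0 i : R) y.
Proof.
split=> [df i|H]; first exact: differentiable_coordf.
have -> : f = \sum_(i < e) (fun z => f z 0 i *: delta_mx 0 i).
  by apply/funext => z; rewrite fct_sumE -row_sum_delta.
by apply: differentiable_sum => i; exact: differentiableZl.
Qed.

Lemma continuous_rowP f y :
  {for y, continuous f} <-> forall i, {for y, continuous (fun z => f z 0 i : R)}.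
Proof.
split=> [cf i|H].
  by apply: (@continuous_comp _ _ _ f (fun z : 'rV[R]_e => z 0 i)) => //;
    exact: coord_continuous.
have -> : f = (fun z => \sum_(i < e) f z 0 i *: delta_mx 0 i).
  by apply/funext => z; rewrite -row_sum_delta.
elim: (index_enum _) => [|i r IH].
  rewrite (_ : (fun _ => _) = cst 0); first exact: cst_continuous.
  by apply/funext => z; rewrite big_nil.
have c1 : {for y, continuous (fun z => f z 0 i *: (delta_mx 0 i : 'rV[R]_e))}.
  apply: (@continuous_comp _ _ _ (fun z => f z 0 i : R) ( *:%R ^~ (delta_mx 0 i))).
    exact: H.
  exact: scalel_continuous.
rewrite (_ : (fun _ => _) = (fun z => f z 0 i *: delta_mx 0 i) +
  (fun z => \sum_(j <- r) f z 0 j *: delta_mx 0 j)).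
  exact (continuousD c1 IH).
by apply/funext => z; rewrite big_cons.
Qed.

Lemma Ck_rowP k U f : open U ->
  Ck k U f <-> forall i, Ck k U (fun y => f y 0 i : R).
Proof.
move=> oU; elim: k f => [|k IH] f.
  split=> [cf i y Uy|H y Uy]; first exact: ((continuous_rowP f y).1 (cf y Uy) i).
  by apply: (continuous_rowP f y).2 => i; exact: (H i y Uy).
split=> [[df cf] i|H].
  split=> [y Uy|v]; first exact: differentiable_coordf (df y Uy).
  have /IH/(_ i) := cf v; apply: Ck_eq => // y Uy.
  by rewrite derive_coordf //; exact: df.
have df y (Uy : U y) : differentiable f y.
  by apply/differentiable_rowP => i; have [/(_ y Uy)] := H i.
split=> // v; apply/IH => i; have [_ /(_ v)] := H i.
by apply: Ck_eq => // y Uy; rewrite derive_coordf //; exact: df.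
Qed.

(** By the chain rule a derivative of [g \o f] is a finite sum of products whose factors are
    derivatives of [f] and partial derivatives of [g] composed with [f]. The latter lose one order,
    so the induction must let [g] vary. *)
Lemma Ck_comp k U V (f : 'rV[R]_d -> 'rV[R]_e) (g : 'rV[R]_e -> R) :
  open U -> open V -> (forall y, U y -> V (f y)) ->
  Ck k U f -> Ck k V g -> Ck k U (g \o f).
Proof.
move=> oU oV UV; elim: k f g UV => [|k IH] f g UV.
  by move=> cf cg y Uy; apply: continuous_comp; [exact: cf | exact/cg/UV].
move=> Cf Cg; have [[df cf] [dg cg]] := (Cf, Cg).
split=> [y Uy|v]; first by apply: differentiable_comp; [exact: df | exact/dg/UV].
apply: (@Ck_eq _ _ _ _ _
    (fun y => \sum_(i < e) ('D_v f y) 0 i * ('D_(delta_mx 0 i) g \o f) y)) => //.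
  move=> y Uy; have dfy := df _ Uy; have dgy := dg _ (UV _ Uy).
  rewrite [RHS]deriveE; last exact: differentiable_comp.
  by rewrite (diff_comp dfy dgy) /= diff_rV_sum // -deriveE.
have Cfi i : Ck k U (fun y => ('D_v f y) 0 i) by apply: (Ck_rowP _ _ oU).1; exact: cf.
have Cgi i : Ck k U ('D_(delta_mx 0 i) g \o f).
  by apply: IH => //; [exact: CkW | exact: cg].
have : forall i : 'I_e, Ck k U (fun y => ('D_v f y) 0 i * ('D_(delta_mx 0 i) g \o f) y).
  by move=> i; apply: CkM.
elim: (index_enum _) => [|i r IHr] H.
  by apply: Ck_eq (Ck_cst k U 0) => // y _; rewrite big_nil.
by apply: Ck_eq (CkD oU (H i) (IHr H)) => // y _; rewrite big_cons.
Qed.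

Lemma Cinf_at_rowP f y :
  Cinf_at f y <-> forall i, Cinf_at (fun z => f z 0 i : R) y.
Proof.
split=> [H i k|H].
  by have [A [oA Ay cA]] := H k; exists A; split=> //; exact: (Ck_rowP _ _ oA).1.
apply: Cinf_atP => k.
have /choice [A HA] : forall i, exists A, nbhs y A /\
    forall U, open U -> U `<=` A -> Ck k U (fun z => f z 0 i : R).
  by move=> i; have [A nA cA] := Cinf_at_Ck k (H i); exists A.
exists [set z | forall i, A i z].
  by apply: (@filter_forall _ _ A (nbhs y) _) => i; have [] := HA i.
move=> U oU UA; apply/(Ck_rowP _ _ oU) => i; have [_] := HA i; apply=> //.
by move=> z /UA.
Qed.

Lemma Cinf_at_comp_real f (g : 'rV[R]_e -> R) y :
  Cinf_at f y -> Cinf_at g (f y) -> Cinf_at (g \o f) y.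
Proof.
move=> Hf Hg; apply: Cinf_atP => k.
have [A nA cA] := Cinf_at_Ck k Hf; have [B [oB By cB]] := Hg k.
exists (A `&` (f @^-1` B)).
  apply: filterI => //.
  exact: (continuous_near_open (Cinf_at_continuous Hf) oB By).
move=> U oU UAB; apply: Ck_comp cB => //; first by move=> z /UAB[].
by apply: cA => // z /UAB[].
Qed.

Lemma Cinf_at_linear (f : {linear 'rV[R]_d -> 'rV[R]_e}) y : Cinf_at f y.
Proof.
apply/Cinf_at_rowP => i.
apply: (@eq_Cinf_at _ _ _ (fun z => \sum_(j < d) z 0 j * f (delta_mx 0 j) 0 i)).
  move=> z; rewrite [in RHS](row_sum_delta z) linear_sum summxE.
  by apply: eq_bigr => j _; rewrite linearZ mxE.
by apply: Cinf_at_sum => j; apply: Cinf_atM; [exact: Cinf_at_coord | exact: Cinf_at_cst].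
Qed.

End CkVector.

Lemma Cinf_at_comp (R : realType) (d e e' : nat) (f : 'rV[R]_d -> 'rV[R]_e)
    (g : 'rV[R]_e -> 'rV[R]_e') y :
  Cinf_at f y -> Cinf_at g (f y) -> Cinf_at (g \o f) y.
Proof.
move=> Hf /Cinf_at_rowP Hg; apply/Cinf_at_rowP => i.
exact: (Cinf_at_comp_real Hf (Hg i)).
Qed.

Lemma diff_linear_rV (R : realType) (d e : nat)
    (f : {linear 'rV[R]_d -> 'rV[R]_e}) y : 'd f y = f :> (_ -> _).
Proof.
apply: diff_lin => z; exact: Cinf_at_continuous (Cinf_at_linear f z).
Qed.

Lemma Cinf_at_id (R : realType) (d : nat) (y : 'rV[R]_d) : Cinf_at id y.
Proof. exact: (Cinf_at_linear idfun). Qed.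

Section CkMatrix.
Variables (R : realType) (d m : nat) (A : 'rV[R]_d -> 'M[R]_m) (y : 'rV[R]_d).
Hypothesis HA : forall i j, Cinf_at (fun z => A z i j : R) y.

Lemma Cinf_at_det : Cinf_at (fun z => \det (A z) : R) y.
Proof.
apply: Cinf_at_sum => s; apply: Cinf_atM; first exact: Cinf_at_cst.
by apply: Cinf_at_prod => i; exact: HA.
Qed.

End CkMatrix.

(** Cramer's rule. [invmx] returns its argument on singular matrices, so the cofactor formula is
    used only near [y], where the determinant stays nonzero. *)
Lemma Cinf_at_invmx (R : realType) (d m : nat) (A : 'rV[R]_d -> 'M[R]_m)
    (y : 'rV[R]_d) :
  (forall i j, Cinf_at (fun z => A z i j : R) y) -> A y \in unitmx ->
  forall i j, Cinf_at (fun z => invmx (A z) i j : R) y.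
Proof.
move=> HA uA i j; have Hdet := Cinf_at_det HA.
have dy0 : \det (A y) != 0 by rewrite -unitfE -unitmxE.
apply: (@near_eq_Cinf_at _ _ _ (fun z => (\det (A z))^-1 * cofactor (A z) j i)).
  apply: filterS (continuous_near_open (Cinf_at_continuous Hdet) (@open_neq R 0) dy0).
  by move=> z dz; rewrite /invmx unitmxE unitfE dz !mxE.
apply: Cinf_atM; first exact: Cinf_atV.
apply: Cinf_atM; first exact: Cinf_at_cst.
by apply: Cinf_at_det => k l; apply: eq_Cinf_at (HA _ _) => z; rewrite !mxE.
Qed.

Lemma continuous_linear_rV (R : realType) (d e : nat)
    (f : {linear 'rV[R]_d -> 'rV[R]_e}) y : {for y, continuous f}.
Proof. exact: Cinf_at_continuous (Cinf_at_linear f y). Qed.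
Arguments continuous_linear_rV {R d e} f y.

Lemma diff_linear_comp (R : realType) (d e e' : nat)
    (L : {linear 'rV[R]_e -> 'rV[R]_e'}) (f : 'rV[R]_d -> 'rV[R]_e) y v :
  differentiable f y -> 'd (L \o f) y v = L ('d f y v).
Proof.
move=> df; have dL : differentiable L (f y) by exact: Cinf_at_diff (Cinf_at_linear L _).
apply: (etrans (congr1 (@^~ v) (diff_comp df dL))).
exact: (congr1 (@^~ ('d f y v)) (diff_linear_rV L (f y))).
Qed.

(** Meant for compositions of a chart with its inverse, which are the identity only locally: off the
    image of the chart, [cinv] takes arbitrary values. *)
Lemma near_id_diff (R : realType) (d : nat) (f : 'rV[R]_d -> 'rV[R]_d) y v :
  {near y, id =1 f} -> 'd f y v = v.
Proof.
move=> H; have di := Cinf_at_diff (Cinf_at_id y).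
apply: (etrans (congr1 (@^~ v) (near_eq_diff H di))).
exact: (congr1 (@^~ v) (diff_linear_rV idfun y)).
Qed.

(** * Smooth maps in charts *)

Lemma open_of_nbhs (T : topologicalType) (A : set T) :
  (forall x, A x -> nbhs x A) -> open A.
Proof. by move=> H; rewrite openE => x /H. Qed.

(** The part of the manifold axioms on which composition of smooth maps relies. It can be invoked
    for products and for the level set as soon as their charts are checked. *)
Definition good_charts (R : realType) (d : nat) (N : charted R d) : Prop :=
  forall x : N, is_chart (chart_at x) /\ cdom (chart_at x) x.

Section Charts.
Variables (R : realType) (T : topologicalType) (d : nat) (c : chart R T d).
Hypothesis Hc : is_chart c.

Lemma cinvK x : cdom c x -> cinv c (cmap c x) = x.
Proof. by case: Hc => _ _ _ _; apply. Qed.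

Lemma cdom_cinv y : (cmap c @` cdom c) y -> cdom c (cinv c y).
Proof. by case=> x Dx <-; rewrite cinvK. Qed.

Lemma cmapK y : (cmap c @` cdom c) y -> cmap c (cinv c y) = y.
Proof. by case=> x Dx <-; rewrite cinvK. Qed.

Lemma near_cdom x : cdom c x -> \forall z \near x, cdom c z.
Proof. by move=> Dx; case: Hc => oD _ _ _ _; exact: open_nbhs_nbhs. Qed.

Lemma near_cim x : cdom c x -> \forall y \near cmap c x, (cmap c @` cdom c) y.
Proof.
by move=> Dx; case: Hc => _ oI _ _ _; apply: open_nbhs_nbhs; split=> //; exists x.
Qed.

Lemma near_cinv x (P : set T) : cdom c x ->
  (\forall z \near x, P z) -> \forall y \near cmap c x, P (cinv c y).
Proof.
move=> Dx nP; case: Hc => _ _ _ cc _.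
have /cc H : (cmap c @` cdom c) (cmap c x) by exists x.
by have := H P; rewrite cinvK //; apply.
Qed.

End Charts.

Section SmoothCalculus.
Variables (R : realType).

Section Comp.
Variables (d e e' : nat) (N : charted R d) (N' : charted R e) (N'' : charted R e').
Hypotheses (gN : good_charts N) (gN' : good_charts N').

Lemma local_expr_comp (f : N -> N') (g : N' -> N'') x : {for x, continuous f} ->
  \forall y \near coord x,
    (local_expr g (f x) \o local_expr f x) y = local_expr (g \o f) x y.
Proof.
move=> cf; have [cx Dx] := gN x; have [cfx Dfx] := gN' (f x).
have nf : \forall z \near x, cdom (chart_at (f x)) (f z).
  exact: (continuous_near_open cf) (let: And5 oD _ _ _ _ := cfx in oD) Dfx.
have ny := near_cinv cx Dx nf; apply: filterS ny => y Dy.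
by rewrite /local_expr /= (cinvK cfx).
Qed.

Lemma local_expr_coord (f : N -> N') x : local_expr f x (coord x) = coord (f x).
Proof.
by have [cx Dx] := gN x; rewrite /local_expr /coord /= (cinvK cx).
Qed.

Lemma smooth_at_comp (f : N -> N') (g : N' -> N'') x :
  smooth_at f x -> smooth_at g (f x) -> smooth_at (g \o f) x.
Proof.
move=> [cf sf] [cg sg]; split; first exact: continuous_comp.
apply: near_eq_Cinf_at (local_expr_comp _ cf) _.
by apply: Cinf_at_comp sf _; rewrite local_expr_coord.
Qed.

Lemma tangent_map_comp (f : N -> N') (g : N' -> N'') x v :
  smooth_at f x -> smooth_at g (f x) ->
  tangent_map (g \o f) x v = tangent_map g (f x) (tangent_map f x v).
Proof.
move=> [cf /Cinf_at_diff df] [cg /Cinf_at_diff dg].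
have lfx := local_expr_coord f x.
have dg' : differentiable (local_expr g (f x)) (local_expr f x (coord x)) by rewrite lfx.
apply: (etrans (congr1 (@^~ v) (near_eq_diff (local_expr_comp g cf) (differentiable_comp df dg')))).
apply: (etrans (congr1 (@^~ v) (diff_comp df dg'))).
by rewrite lfx.
Qed.

End Comp.

Section Near.
Variables (d e : nat) (N : charted R d) (N' : charted R e).
Hypothesis gN : good_charts N.

Lemma near_local_expr (f g : N -> N') x : {near x, f =1 g} ->
  {near coord x, local_expr f x =1 local_expr g x}.
Proof.
move=> fg; have [cx Dx] := gN x; have := near_cinv cx Dx fg.
by apply: filterS => y fgy; rewrite /local_expr /= fgy (nbhs_singleton fg).
Qed.

Lemma near_smooth_at (f g : N -> N') x : {near x, f =1 g} ->
  smooth_at f x -> smooth_at g x.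
Proof.
move=> fg [cf sf]; split; last exact: near_eq_Cinf_at (near_local_expr fg) sf.
rewrite /prop_for /continuous_at -(nbhs_singleton fg).
exact: cvg_trans (near_eq_cvg fg) cf.
Qed.

Lemma near_tangent_map (f g : N -> N') x : {near x, f =1 g} -> smooth_at f x ->
  tangent_map g x =1 tangent_map f x.
Proof.
move=> fg [_ sf] v; rewrite /tangent_map.
have nl := near_local_expr fg; have dl := Cinf_at_diff sf.
exact (congr1 (@^~ v) (near_eq_diff nl dl)).
Qed.

Lemma tangent_map_linear (f : N -> N') x : linear (tangent_map f x).
Proof. by move=> a u v; rewrite /tangent_map linearP. Qed.

Lemma local_expr_id (x : N) : {near coord x, id =1 local_expr (@id N) x}.
Proof.
have [cx Dx] := gN x; apply: filterS (near_cim cx Dx) => y Iy.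
by rewrite /local_expr /= (cmapK cx).
Qed.

Lemma smooth_at_id (x : N) : smooth_at (@id N) x.
Proof.
split; first by move=> A.
exact: near_eq_Cinf_at (local_expr_id x) (Cinf_at_id _).
Qed.

Lemma tangent_map_id (x : N) v : tangent_map (@id N) x v = v.
Proof.
exact: (near_id_diff v (local_expr_id x)).
Qed.

Lemma smooth_at_cst (a : N') (x : N) : smooth_at (fun=> a) x.
Proof. by split; [exact: cst_continuous | exact: Cinf_at_cst]. Qed.

Lemma tangent_map_cst (a : N') (x : N) v :
  tangent_map (fun=> a) x v = 0.
Proof.
rewrite /tangent_map (_ : local_expr _ _ = cst (coord a)) //.
by rewrite diff_cst.
Qed.

End Near.

End SmoothCalculus.

Lemma real_line_good (R : realType) : good_charts (real_line R).
Proof.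
move=> x; split=> //; split=> /=; first exact: openT.
- rewrite (_ : _ @` _ = setT); first exact: openT.
  apply/seteqP; split=> // y _; exists (y 0 0) => //.
  by apply/rowP => i; rewrite !mxE ord1.
- move=> t _ /=; rewrite (_ : (fun _ => _) = ( *:%R ^~ (const_mx 1 : 'rV[R]_1))).
    exact: scalel_continuous.
  by apply/funext => u; apply/rowP => i; rewrite !mxE mulr1.
- by move=> y _; exact: coord_continuous.
- by move=> t _; rewrite mxE.
Qed.

Section RealFunctions.
Variables (R : realType) (d : nat) (N : charted R d).
Hypothesis gN : good_charts N.
Implicit Types f g : N -> R.

Definition smooth_real f x := @smooth_at R d 1 N (real_line R) f x.

Lemma smooth_realP f x :
  smooth_real f x <-> Cinf_at (fun y => f (cinv (chart_at x) y) : R) (coord x).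
Proof.
split=> [[_ /Cinf_at_rowP/(_ 0)]|H].
  by apply: eq_Cinf_at => y; rewrite /local_expr /= mxE.
have [cx Dx] := gN x; split; last first.
  by apply/Cinf_at_rowP => i; apply: eq_Cinf_at H => y; rewrite /local_expr /= mxE.
(* In this direction continuity of [f] has to be produced: it is that of the coordinate expression
   composed with the chart. *)
have /Cinf_at_continuous cF := H.
have cm : {for x, continuous (cmap (chart_at x))} by case: cx => _ _ /(_ _ Dx).
have nf : {near x, (fun y => f (cinv (chart_at x) y)) \o cmap (chart_at x) =1 f}.
  by apply: filterS (near_cdom cx Dx) => z Dz /=; rewrite (cinvK cx).
rewrite /prop_for /continuous_at -[X in _ --> X](nbhs_singleton nf).
apply: cvg_trans (near_eq_cvg nf) _.
exact: (continuous_comp cm cF).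
Qed.

Lemma smooth_realM f g x : smooth_real f x -> smooth_real g x ->
  smooth_real (fun z => f z * g z) x.
Proof. by move=> /smooth_realP sf /smooth_realP sg; apply/smooth_realP/Cinf_atM. Qed.

Lemma smooth_realV f x : f x != 0 -> smooth_real f x ->
  smooth_real (fun z => (f z)^-1) x.
Proof.
move=> fx0 /smooth_realP sf; apply/smooth_realP; apply: Cinf_atV => //.
by have [cx Dx] := gN x; rewrite /coord (cinvK cx).
Qed.

Lemma smooth_real_sqrt f x : 0 < f x -> smooth_real f x ->
  smooth_real (fun z => Num.sqrt (f z)) x.
Proof.
move=> fx0 /smooth_realP sf; apply/smooth_realP; apply: Cinf_at_sqrt => //.
by have [cx Dx] := gN x; rewrite /coord (cinvK cx).
Qed.

End RealFunctions.

(** * Products of charted spaces *)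

Section RowPairs.
Variables (R : realType) (m n : nat).

Let A : {linear 'rV[R]_m -> 'rV[R]_(m + n)} := mulmxr (row_mx 1%:M 0).
Let B : {linear 'rV[R]_n -> 'rV[R]_(m + n)} := mulmxr (row_mx 0 1%:M).

(** Concatenation as a sum of two linear maps: continuity, smoothness and differentials of a pair
    reduce to those of sums and of linear maps. *)
Lemma row_mx_mulE (u : 'rV[R]_m) (v : 'rV[R]_n) :
  row_mx u v = A u + B v.
Proof.
by rewrite /= !mul_mx_row !mulmx1 !mulmx0 add_row_mx addr0 add0r.
Qed.

Lemma continuous_row_mx (T : topologicalType) (f : T -> 'rV[R]_m)
    (g : T -> 'rV[R]_n) z : {for z, continuous f} -> {for z, continuous g} ->
  {for z, continuous (fun t => row_mx (f t) (g t))}.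
Proof.
move=> cf cg.
have c1 := continuous_comp cf (continuous_linear_rV A (f z)).
have c2 := continuous_comp cg (continuous_linear_rV B (g z)).
rewrite (_ : (fun _ => _) = (A \o f) + (B \o g)).
  exact (continuousD c1 c2).
by apply/funext => t; rewrite row_mx_mulE.
Qed.

Lemma Cinf_at_row_mx d (f : 'rV[R]_d -> 'rV[R]_m) (g : 'rV[R]_d -> 'rV[R]_n) y :
  Cinf_at f y -> Cinf_at g y -> Cinf_at (fun z => row_mx (f z) (g z)) y.
Proof.
move=> Hf Hg.
have c1 := Cinf_at_comp Hf (Cinf_at_linear A _).
have c2 := Cinf_at_comp Hg (Cinf_at_linear B _).
by apply: eq_Cinf_at (Cinf_atD c1 c2) => z; rewrite row_mx_mulE.
Qed.

Lemma diff_row_mx d (f : 'rV[R]_d -> 'rV[R]_m) (g : 'rV[R]_d -> 'rV[R]_n) y v :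
  differentiable f y -> differentiable g y ->
  'd (fun z => row_mx (f z) (g z)) y v = row_mx ('d f y v) ('d g y v).
Proof.
move=> df dg.
have E : (fun z => row_mx (f z) (g z)) = (A \o f) + (B \o g).
  by apply/funext => t; rewrite row_mx_mulE.
have dAf : differentiable (A \o f) y.
  by apply: (differentiable_comp df); exact: Cinf_at_diff (Cinf_at_linear A _).
have dBg : differentiable (B \o g) y.
  by apply: (differentiable_comp dg); exact: Cinf_at_diff (Cinf_at_linear B _).
apply: (etrans (congr1 (fun k => 'd k y v) E)).
apply: (etrans (congr1 (@^~ v) (diffD dAf dBg))).
rewrite row_mx_mulE; congr (_ + _); exact: diff_linear_comp.
Qed.

End RowPairs.

Lemma near_continuous (S T : topologicalType) (f : S -> T) x (Q : T -> Prop) :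
  {for x, continuous f} -> (\forall z \near f x, Q z) -> \forall y \near x, Q (f y).
Proof. by move=> cf nQ; have := cf _ nQ. Qed.

Lemma continuous_pair (T S S' : topologicalType) (f : T -> S) (g : T -> S') z :
  {for z, continuous f} -> {for z, continuous g} ->
  {for z, continuous (fun t => (f t, g t))}.
Proof. by move=> cf cg; exact: cvg_pair. Qed.

Section Products.
Variables (R : realType) (d e : nat) (N : charted R d) (N' : charted R e).
Hypotheses (gN : good_charts N) (gN' : good_charts N').

Lemma prod_good : good_charts (prod_charted N N').
Proof.
move=> [a b]; have [ca Da] := gN a; have [cb Db] := gN' b; split=> //.
case: ca cb => [oDa oIa ma ia Ka] [oDb oIb mb ib Kb]; split=> /=.
- apply: open_of_nbhs => -[u v] [/= Du Dv].
  have nu : nbhs u (cdom (chart_at a)) by exact: open_nbhs_nbhs.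
  have nv : nbhs v (cdom (chart_at b)) by exact: open_nbhs_nbhs.
  by exists (cdom (chart_at a), cdom (chart_at b)).
- rewrite (_ : _ @` _ = lsubmx @^-1` (cmap (chart_at a) @` cdom (chart_at a)) `&`
      rsubmx @^-1` (cmap (chart_at b) @` cdom (chart_at b))).
    apply: openI; apply: open_comp => // y _.
      exact: continuous_lsubmx.
    exact: continuous_rsubmx.
  apply/seteqP; split=> [_ [[u v] [/= Du Dv] <-]|y [[u Du ul] [v Dv vr]]].
    by split; rewrite /= ?row_mxKl ?row_mxKr; [exists u|exists v].
  by exists (u, v) => //=; rewrite ul vr hsubmxK.
- move=> [u v] [/= Du Dv]; apply: (@continuous_row_mx _ _ _ _
      (fun w : N * N' => cmap (chart_at a) w.1) (fun w => cmap (chart_at b) w.2)).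
    apply: (@continuous_comp _ _ _ (@fst N N') (cmap (chart_at a))); last exact: ma.
    exact: cvg_fst.
  apply: (@continuous_comp _ _ _ (@snd N N') (cmap (chart_at b))); last exact: mb.
  exact: cvg_snd.
- move=> _ [[u v] [/= Du Dv] <-].
  set y := row_mx _ _; have yl : lsubmx y = cmap (chart_at a) u by rewrite row_mxKl.
  have yr : rsubmx y = cmap (chart_at b) v by rewrite row_mxKr.
  have c1 : {for lsubmx y, continuous (cinv (chart_at a))} by apply: ia; rewrite yl; exists u.
  have c2 : {for rsubmx y, continuous (cinv (chart_at b))} by apply: ib; rewrite yr; exists v.
  have l1 := continuous_linear_rV (lsubmx : {linear 'rV[R]_(d + e) -> 'rV[R]_d}) y.
  have l2 := continuous_linear_rV (rsubmx : {linear 'rV[R]_(d + e) -> 'rV[R]_e}) y.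
  exact: (continuous_pair (continuous_comp l1 c1) (continuous_comp l2 c2)).
- by move=> [u v] [/= Du Dv]; rewrite row_mxKl row_mxKr Ka // Kb.
Qed.

Lemma smooth_at_snd (z : prod_charted N N') :
  smooth_at (M := prod_charted N N') (N := N') snd z.
Proof.
split; first exact: cvg_snd.
have [ca Da] := gN' z.2; have [cz Dz] := prod_good z.
have Hl := @Cinf_at_linear R _ _ (rsubmx : {linear 'rV[R]_(d + e) -> 'rV[R]_e}) (coord z).
apply: near_eq_Cinf_at Hl.
apply: filterS (near_cim cz Dz) => _ [[u v] [/= Du Dv] <-].
by rewrite /local_expr /= !row_mxKr (cinvK ca).
Qed.

Lemma smooth_at_pair k (X : charted R k) (f : X -> N) (g : X -> N') x :
  smooth_at f x -> smooth_at g x ->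
  smooth_at (N := prod_charted N N') (fun z => (f z, g z)) x.
Proof.
move=> [cf sf] [cg sg]; split; first exact: cvg_pair.
by apply: eq_Cinf_at (Cinf_at_row_mx sf sg) => y.
Qed.

Lemma tangent_map_pair k (X : charted R k) (f : X -> N) (g : X -> N') x v :
  smooth_at f x -> smooth_at g x ->
  tangent_map (N := prod_charted N N') (fun z => (f z, g z)) x v =
  row_mx (tangent_map f x v) (tangent_map g x v).
Proof.
move=> [cf sf] [cg sg].
exact: (diff_row_mx v (Cinf_at_diff sf) (Cinf_at_diff sg)).
Qed.

End Products.

Definition smooth_charts (R : realType) (d : nat) (N : charted R d) : Prop :=
  good_charts N /\ forall x x' z : N, cdom (chart_at x) z -> cdom (chart_at x') z ->
    Cinf_at (cmap (chart_at x') \o cinv (chart_at x)) (cmap (chart_at x) z).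

Lemma smooth_manifold_charts (R : realType) (d : nat) (N : charted R d) :
  smooth_manifold N -> smooth_charts N.
Proof. by case. Qed.

Lemma real_line_charts (R : realType) : smooth_charts (real_line R).
Proof.
split; first exact: real_line_good.
move=> x x' z _ _; apply: eq_Cinf_at (Cinf_at_id _) => y.
by apply/rowP => i; rewrite /= mxE ord1.
Qed.

Lemma prod_smooth_charts (R : realType) (d e : nat) (N : charted R d)
    (N' : charted R e) :
  smooth_charts N -> smooth_charts N' -> smooth_charts (prod_charted N N').
Proof.
move=> [gN cN] [gN' cN']; split; first exact: prod_good.
move=> x x' z [Dz1 Dz2] [Dz1' Dz2'] /=.
apply: (@Cinf_at_row_mx _ _ _ _
    ((cmap (chart_at x'.1) \o cinv (chart_at x.1)) \o lsubmx)
    ((cmap (chart_at x'.2) \o cinv (chart_at x.2)) \o rsubmx)).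
  apply: Cinf_at_comp; last by rewrite /= row_mxKl; exact: cN.
  exact: (Cinf_at_linear (lsubmx : {linear 'rV[R]_(d + e) -> 'rV[R]_d})).
apply: Cinf_at_comp; last by rewrite /= row_mxKr; exact: cN'.
exact: (Cinf_at_linear (rsubmx : {linear 'rV[R]_(d + e) -> 'rV[R]_e})).
Qed.

(* The identification, implicit in [local_tensor], of the coordinate space at [x]
   with the tangent space at the point of coordinates [y]. *)
Definition transition (R : realType) (d : nat) (N : charted R d) (x : N)
    (y : 'rV[R]_d) : 'rV[R]_d -> 'rV[R]_d :=
  'd (cmap (chart_at (cinv (chart_at x) y)) \o cinv (chart_at x)) y.

Section Transition.
Variables (R : realType) (d : nat) (N : charted R d).
Hypothesis sN : smooth_charts N.
Let gN : good_charts N := sN.1.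

Lemma transition_linear (x : N) y : linear (transition x y).
Proof. by move=> a u v; rewrite /transition linearP. Qed.

Lemma transition_coord (x : N) v : transition x (coord x) v = v.
Proof.
have [cx Dx] := gN x; have E : cinv (chart_at x) (coord x) = x by rewrite (cinvK cx).
rewrite /transition E.
have H : {near coord x, id =1 cmap (chart_at x) \o cinv (chart_at x)}.
  by apply: filterS (near_cim cx Dx) => y Iy /=; rewrite (cmapK cx).
exact: near_id_diff.
Qed.

Lemma Cinf_at_change (x x' z : N) : cdom (chart_at x) z -> cdom (chart_at x') z ->
  Cinf_at (cmap (chart_at x') \o cinv (chart_at x)) (cmap (chart_at x) z).
Proof. exact: sN.2. Qed.

(** The differential of the reverse change of chart is a right inverse, by the chain rule for a
    composition that is locally the identity. *)
Lemma transition_surj (x : N) y : (cmap (chart_at x) @` cdom (chart_at x)) y ->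
  forall w, exists v, transition x y v = w.
Proof.
move=> [z Dz <-] w; have [cx _] := gN x; have [cz Dzz] := gN z.
pose A := cmap (chart_at z) \o cinv (chart_at x).
pose B := cmap (chart_at x) \o cinv (chart_at z).
have dA : differentiable A (cmap (chart_at x) z) by exact: Cinf_at_diff (Cinf_at_change _ _).
have dB : differentiable B (coord z) by exact: Cinf_at_diff (Cinf_at_change _ _).
have EB : B (coord z) = cmap (chart_at x) z by rewrite /B /coord /= (cinvK cz).
exists ('d B (coord z) w); rewrite /transition (cinvK cx Dz) -EB.
have dA' : differentiable A (B (coord z)) by rewrite EB.
apply: (etrans (esym (congr1 (@^~ w) (diff_comp dB dA')))).
have H : {near coord z, id =1 A \o B}.
  apply: filterS2 (near_cim cz Dzz) (near_cinv cz Dzz (near_cdom cx Dz)) => y' Iy Dy.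
  by rewrite /A /B /= (cinvK cx) // (cmapK cz).
exact: near_id_diff.
Qed.

End Transition.

(** The chain rule for [f] seen in two pairs of charts. On the left the charts vary with the point;
    on the right a single local expression is differentiated, so that its dependence on [y] is
    smooth. *)
Lemma tangent_map_transition (R : realType) (d e : nat) (N : charted R d)
    (N' : charted R e) (f : N -> N') (x : N) :
  smooth_charts N -> smooth_charts N' -> smooth_at f x ->
  \forall y \near coord x, smooth_at f (cinv (chart_at x) y) -> forall v,
    tangent_map f (cinv (chart_at x) y) (transition x y v) =
    transition (f x) (local_expr f x y) ('d (local_expr f x) y v).
Proof.
move=> sN sN' [cf sf].
have gN := sN.1; have gN' := sN'.1.
have [cx Dx] := gN x; have [cfx Dfx] := gN' (f x).
have ofx : open (cdom (chart_at (f x))) by case: cfx.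
have n1 := near_cim cx Dx.
have n2 := near_cinv cx Dx (continuous_near_open cf ofx Dfx).
have n3 := Cinf_at_near sf.
apply: filterS3 n1 n2 n3 => y Iy Dfy dy sfz v.
have Dz := cdom_cinv cx Iy; have Kz := cmapK cx Iy.
set z := cinv (chart_at x) y in Dfy sfz Dz Kz *.
have [cz Dzz] := gN z; have [cfz Dfz] := gN' (f z).
have Efz : cinv (chart_at (f x)) (local_expr f x y) = f z.
  by rewrite /local_expr /= (cinvK cfx).
rewrite /transition Efz -/z.
pose A := cmap (chart_at z) \o cinv (chart_at x).
pose B := cmap (chart_at (f z)) \o cinv (chart_at (f x)).
have dA : differentiable A y.
  by rewrite -Kz; exact: Cinf_at_diff (Cinf_at_change sN _ _).
have dB : differentiable B (local_expr f x y).
  exact: Cinf_at_diff (Cinf_at_change sN' Dfy Dfz).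
have EA : A y = coord z by [].
have dlf : differentiable (local_expr f z) (A y).
  by rewrite EA; have [_ /Cinf_at_diff] := sfz.
rewrite /tangent_map -EA.
apply: (etrans (esym (congr1 (@^~ v) (diff_comp dA dlf)))).
apply: (etrans _ (congr1 (@^~ v) (diff_comp dy dB))).
suff H : {near y, B \o local_expr f x =1 local_expr f z \o A}.
  exact: (congr1 (@^~ v) (near_eq_diff H (differentiable_comp dy dB))).
have n4 : \forall y' \near y, cdom (chart_at z) (cinv (chart_at x) y').
  by rewrite -Kz; apply: near_cinv => //; exact: near_cdom.
have n5 : \forall y' \near y, cdom (chart_at (f x)) (f (cinv (chart_at x) y')).
  have [cfz' _] := sfz; have n6 := continuous_near_open cfz' ofx Dfy.
  by have := near_cinv cx Dz n6; rewrite Kz.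
apply: filterS2 n4 n5 => y' Dy' Dfy'.
by rewrite /A /B /local_expr /= (cinvK cfx) // (cinvK cz).
Qed.

(** * Multilinear algebra *)

Section LinearFunctionals.
Variables (R : realType) (d : nat).
Implicit Types (xi eta : 'rV[R]_d -> R).

(** A bare predicate, because covectors arise as partial evaluations [fun u => a x (fun=> u)] of
    tensors, which carry no bundled linear structure. *)
Definition linear_fun xi := forall c u w, xi (c *: u + w) = c * xi u + xi w.

Lemma linear_fun0 xi : linear_fun xi -> xi 0 = 0.
Proof. by move=> L; have := L (-1) 0 0; rewrite scaler0 addr0 mulN1r addNr. Qed.

Lemma linear_funZ xi c u : linear_fun xi -> xi (c *: u) = c * xi u.
Proof. by move=> L; have := L c u 0; rewrite (linear_fun0 L) !addr0. Qed.

Lemma linear_funB xi u w : linear_fun xi -> xi (u - w) = xi u - xi w.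
Proof. by move=> L; rewrite addrC -scaleN1r L mulN1r addrC. Qed.

Lemma linear_fun_sum xi u : linear_fun xi ->
  xi u = \sum_(j < d) u 0 j * xi (delta_mx 0 j).
Proof.
move=> L; rewrite {1}(row_sum_delta u); elim: (index_enum _) => [|j r IH].
  by rewrite !big_nil (linear_fun0 L).
by rewrite !big_cons L IH.
Qed.

(* The difference [u - (xi u / xi v) v] lies in the kernel of [xi]. *)
Lemma linear_fun_proportional xi eta v : linear_fun xi -> linear_fun eta ->
  xi v != 0 -> (forall u, xi u = 0 -> eta u = 0) ->
  forall u, eta u = eta v / xi v * xi u.
Proof.
move=> Lx Le xv0 ker u.
have : eta (u - (xi u / xi v) *: v) = 0.
  by apply: ker; rewrite linear_funB // linear_funZ // divfK // subrr.
rewrite linear_funB // linear_funZ // => /eqP; rewrite subr_eq0 => /eqP ->.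
by rewrite mulrAC [RHS]mulrAC [xi u * _]mulrC.
Qed.

(** A vector of [C] outside the kernel would span, together with the kernel, the whole space,
    against the dimension bound. *)
Lemma hyperplane_kernel xi (C : {vspace 'rV[R]_d}) : linear_fun xi ->
  (\dim C < d)%N -> (forall u, xi u = 0 -> u \in C) ->
  forall u, u \in C <-> xi u = 0.
Proof.
move=> L dC kC u; split; last exact: kC.
move=> uC; apply: contrapT => /eqP xu0.
have : (fullv <= C)%VS.
  apply/subvP => w _; rewrite -(subrK ((xi w / xi u) *: u) w).
  apply: rpredD; last exact: rpredZ.
  by apply: kC; rewrite linear_funB // linear_funZ // divfK // subrr.
by move/dimvS; rewrite dimvf /dim /= mul1n leqNgt dC.
Qed.

Lemma pair_ofE (w : 'I_2 -> 'rV[R]_d) : w = pair_of (w ord0) (w (lift ord0 ord0)).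
Proof.
apply/funext => i; rewrite /pair_of; case: (unliftP ord0 i) => [j ->|-> //].
by rewrite (ord1 j).
Qed.

Lemma multilinear1P (a : tensor R d 1) : multilinear a <->
  linear_fun (fun u => a (fun=> u)).
Proof.
split=> [H c u w|H i v c u w].
  have := H ord0 (fun=> 0) c u w.
  suff E z : (fun j : 'I_1 => if j == ord0 then z else (0 : 'rV[R]_d)) = (fun=> z).
    by rewrite /= !E.
  by apply/funext => j; rewrite ord1.
have E z : (fun j : 'I_1 => if j == i then z else v j) = (fun=> z).
  by apply/funext => j; rewrite !ord1 eqxx.
by rewrite /= !E; exact: H.
Qed.

Lemma multilinear2P (a : tensor R d 2) : multilinear a <->
  (forall v, linear_fun (fun u => a (pair_of u v))) /\
  (forall u, linear_fun (fun v => a (pair_of u v))).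
Proof.
split=> [H|[Hl Hr] i v c u w].
  split=> [v c u w|u c v w].
    have := H ord0 (pair_of u v) c u w.
    suff E z : (fun j : 'I_2 => if j == ord0 then z else pair_of u v j) = pair_of z v.
      by rewrite /= !E.
    by apply/funext => j; rewrite /pair_of; case: (j == ord0).
  have := H (lift ord0 ord0) (pair_of u v) c v w.
  suff E z : (fun j : 'I_2 => if j == lift ord0 ord0 then z else pair_of u v j) =
      pair_of u z by rewrite /= !E.
  apply/funext => j; rewrite /pair_of; case: (unliftP ord0 j) => [k ->|->//].
  by rewrite (ord1 k) eqxx.
case: (unliftP ord0 i) => [k ->|->].
  rewrite (ord1 k).
  suff E z : (fun j : 'I_2 => if j == lift ord0 ord0 then z else v j) =
      pair_of (v ord0) z by rewrite /= !E; exact: Hr.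
  by rewrite [LHS]pair_ofE.
suff E z : (fun j : 'I_2 => if j == ord0 then z else v j) =
    pair_of z (v (lift ord0 ord0)) by rewrite /= !E; exact: Hl.
by rewrite [LHS]pair_ofE.
Qed.

End LinearFunctionals.

(** * Wedge products and their rescaling *)

Section Wedge.
Variables (R : realType) (d : nat).

Lemma multilinear_wedge k l (a : tensor R d k) (b : tensor R d l) :
  multilinear a -> multilinear b -> multilinear (wedge a b).
Proof.
move=> ma mb i v c u w; rewrite /wedge /=.
rewrite mulrCA -mulrDr; congr (_ * _).
rewrite mulr_sumr -big_split; apply: eq_bigr => s _ /=.
have eqs j : (s j == i) = (j == (s^-1)%g i).
  by apply/eqP/eqP => [<-|->]; rewrite ?permK ?permKV.
(* The slot [i] feeds a single argument, the one at index [s^-1 i]. It belongs either to [a] or to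
   [b], and the other factor does not see it. *)
case: (split_ordP ((s^-1)%g i)) => q Eq.
  have Eb z : (fun j : 'I_l => if s (rshift k j) == i then z else v (s (rshift k j))) =
      (fun j => v (s (rshift k j))).
    by apply/funext => j; rewrite eqs Eq eq_rlshift.
  have Ea z : (fun j : 'I_k => if s (lshift l j) == i then z else v (s (lshift l j))) =
      (fun j => if j == q then z else v (s (lshift l j))).
    by apply/funext => j; rewrite eqs Eq eq_lshift.
  have := ma q (fun j => v (s (lshift l j))) c u w; rewrite !Eb !Ea /= => ->.
  by rewrite mulrDr mulrDl; congr (_ + _); rewrite -!mulrA mulrCA.
have Ea z : (fun j : 'I_k => if s (lshift l j) == i then z else v (s (lshift l j))) =
    (fun j => v (s (lshift l j))).
  by apply/funext => j; rewrite eqs Eq eq_lrshift.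
have Eb z : (fun j : 'I_l => if s (rshift k j) == i then z else v (s (rshift k j))) =
    (fun j => if j == q then z else v (s (rshift k j))).
  by apply/funext => j; rewrite eqs Eq eq_rshift.
have := mb q (fun j => v (s (rshift k j))) c u w; rewrite !Eb !Ea /= => ->.
by rewrite mulrDr mulrCA.
Qed.

Lemma alternating_wedge k l (a : tensor R d k) (b : tensor R d l) :
  Defs.alternating (wedge a b).
Proof.
move=> v i j ij vij; rewrite /wedge.
set F := fun s : 'S_(k + l) => _.
set S := \sum_s _; suff -> : S = 0 by rewrite mulr0.
pose t := tperm i j.
have vt k' : v (t k') = v k' by rewrite /t; case: tpermP => // ->.
(* Reindexing by [s * t] exchanges the equal vectors [v i] and [v j] and flips the sign of the
   permutation. *)
have : S = - S.
  rewrite {1}/S (reindex_inj (mulIg t)) /= -sumrN; apply: eq_bigr => s _.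
  have Es k' : v ((s * t)%g k') = v (s k') by rewrite permM vt.
  under [X in a X]funext do rewrite Es.
  under [X in b X]funext do rewrite Es.
  by rewrite odd_permM odd_tperm ij /= signr_addb mulrN1 !mulNr.
by move/eqP; rewrite -addr_eq0 -mulr2n mulrn_eq0 /= => /eqP.
Qed.

Lemma multilinear_wedge_exp (b : tensor R d 2) n : multilinear b ->
  multilinear (wedge_exp b n).
Proof.
move=> mb; elim: n => [|n IH]; first by case.
exact: (@multilinear_wedge 2 n.*2).
Qed.

(** Permutations only redistribute the vectors [v i], all in [K], among the factors, so each of the
    [n] factors contributes one [f]. *)
Lemma wedge_exp_rescale (b b' : tensor R d 2) (f : R) (K : set 'rV[R]_d) n v :
  (forall w, (forall i, K (w i)) -> b' w = f * b w) -> (forall i, K (v i)) ->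
  wedge_exp b' n v = f ^+ n * wedge_exp b n v.
Proof.
move=> Hb; elim: n v => [|n IH] v Kv; first by rewrite expr0 mul1r.
rewrite /= /wedge exprS mulrCA; congr (_ * _).
rewrite mulr_sumr; apply: eq_bigr => s _.
rewrite Hb => [|i]; last exact: Kv.
rewrite IH => [|i]; last exact: Kv.
by move: (b _) (wedge_exp b n _) (f ^+ n) ((-1) ^+ s) => x y z t; ring.
Qed.

(* Subtracting multiples of one vector from the others puts the latter in the
   kernel of [a] without changing the value of an alternating form. *)
Lemma adapted_vectors k (om : tensor R d k) (a : 'rV[R]_d -> R) v i0 :
  multilinear om -> Defs.alternating om -> linear_fun a -> a (v i0) != 0 ->
  exists v', om v' = om v /\ forall j, j != i0 -> a (v' j) = 0.
Proof.
move=> mo ao la ai0.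
pose v' j := - (a (v j) / a (v i0)) *: v i0 + v j.
(* Vectors are replaced one at a time along a list, slot [i0] being left alone. Each replacement
   adds a multiple of [v i0], which slot [i0] already holds, so alternation kills the difference. *)
pose vr (r : seq 'I_k) j := if (j \in r) && (j != i0) then v' j else v j.
have vr_om r : om (vr r) = om v.
  elim: r => [|i r IH]; first by congr om; apply/funext.
  case: (boolP ((i == i0) || (i \in r))) => [Hi|].
    rewrite -IH; congr om; apply/funext => j; rewrite /vr inE.
    case: eqVneq => //= ->.
    by case/orP: Hi => [->|->]; rewrite ?andbF.
  rewrite negb_or => /andP[ii0 ir].
  have -> : vr (i :: r) = (fun j => if j == i then v' i else vr r j).
    apply/funext => j; rewrite /vr inE; case: eqVneq => //= ->.
    by rewrite ii0.
  rewrite /v' (mo i (vr r)) (ao _ i i0) // ?mulr0 ?add0r; last first.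
    by rewrite eqxx eq_sym (negPf ii0) /vr eqxx andbF.
  rewrite -IH; congr om; apply/funext => j; case: eqVneq => // ->.
  by rewrite /vr (negPf ir).
exists (vr (enum 'I_k)); split=> // j ji0; rewrite /vr mem_enum ji0 /= /v' la.
by rewrite mulNr divfK // addNr.
Qed.

(** The relation between [b'] and [b] is stated on the kernel of [a] because [d(f a)] and [f da]
    differ by [df /\ a], which vanishes there. *)
Lemma wedge_contact_rescale (a a' : tensor R d 1) (b b' : tensor R d 2) f n :
  multilinear a -> multilinear b -> f != 0 ->
  (forall u, a' u = f * a u) ->
  (forall w, (forall i, a (fun=> w i) = 0) -> b' w = f * b w) ->
  (exists v, wedge a (wedge_exp b n) v != 0) ->
  exists v, wedge a' (wedge_exp b' n) v != 0.
Proof.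
move=> ma mb f0 Ha Hb [v v0].
have la := (multilinear1P a).1 ma.
have aE w : a w = a (fun=> w ord0).
  by congr a; apply/funext => i; rewrite ord1.
have [i0 ai0] : exists i0, a (fun=> v i0) != 0.
  apply: contrapT => H; move/negP: v0; apply; rewrite /wedge.
  rewrite big1 ?mulr0 // => s _; rewrite aE /=.
  case: (eqVneq (a (fun=> v (s (lshift n.*2 ord0)))) 0) => [->|nz].
    by rewrite mulr0 mul0r.
  by case: H; exists (s (lshift n.*2 ord0)).
have [v' [ov' kv']] := adapted_vectors (multilinear_wedge ma (multilinear_wedge_exp (n := n) mb))
  (@alternating_wedge _ _ _ _) la ai0.
exists v'; suff -> : wedge a' (wedge_exp b' n) v' =
    f ^+ n.+1 * wedge a (wedge_exp b n) v'.
  by rewrite mulf_neq0 ?expf_neq0 // ov'.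
rewrite /wedge mulrCA; congr (_ * _); rewrite mulr_sumr; apply: eq_bigr => s _.
(* In a summand whose [a]-factor is nonzero, slot [i0] goes to [a], so the power of [b] receives
   only kernel vectors. The exponent [n.+1] counts one [f] from [a] and [n] from the power. *)
rewrite Ha; case: (eqVneq (a (fun i => v' (s (lshift n.*2 i)))) 0) => [->|nz].
  by rewrite !(mulr0, mul0r).
rewrite (wedge_exp_rescale (K := [set u | a (fun=> u) = 0]) (n := n) Hb) => [|i /=].
  by rewrite exprS; move: (a _) (wedge_exp b n _) (f ^+ n) ((-1) ^+ s) => x y z t; ring.
apply: (kv' (s (rshift 1 i))); apply: contra nz => /eqP si; rewrite aE /= kv' //.
by rewrite -si (inj_eq perm_inj) eq_lrshift.
Qed.

End Wedge.

(** * Tensor fields in charts *)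

Section LocalTensors.
Variables (R : realType) (d : nat) (N : charted R d).
Hypothesis sN : smooth_charts N.

Lemma local_tensor_coord k (a : tensor_field N k) x v :
  local_tensor a x (coord x) v = a x v.
Proof.
have [cx Dx] := sN.1 x; rewrite /local_tensor.
have E : cinv (chart_at x) (coord x) = x by rewrite (cinvK cx).
rewrite -[X in a _ X]/(fun i => transition x (coord x) (v i)).
rewrite [X in a _ X](_ : _ = v) ?E //.
by apply/funext => i; rewrite (transition_coord sN).
Qed.

Lemma local_tensor1_linear (a : tensor_field N 1) x y :
  multilinear (a (cinv (chart_at x) y)) ->
  linear_fun (fun u => local_tensor a x y (fun=> u)).
Proof.
move=> /multilinear1P H c u w; rewrite /local_tensor -H; congr (a _ _).
by apply/funext => _; rewrite linearP.
Qed.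

Lemma local_tensor_pair (a : tensor_field N 2) x y u v :
  local_tensor a x y (pair_of u v) =
  a (cinv (chart_at x) y) (pair_of (transition x y u) (transition x y v)).
Proof.
by rewrite /local_tensor; congr (a _ _); apply/funext => i; rewrite /pair_of; case: ifP.
Qed.

(** Smoothness of a tensor is defined on constant vectors. A moving vector is expanded in the
    standard basis, and multilinearity at the nearby points gives a finite sum of smooth
    products. *)
Lemma Cinf_local1 (a : tensor_field N 1) x (V : 'rV[R]_d -> 'rV[R]_d) :
  (forall v, Cinf_at (fun y => local_tensor a x y v : R) (coord x)) ->
  (\forall z \near x, multilinear (a z)) -> Cinf_at V (coord x) ->
  Cinf_at (fun y => local_tensor a x y (fun=> V y) : R) (coord x).
Proof.
move=> sa ma /Cinf_at_rowP sV; have [cx Dx] := sN.1 x.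
apply: (@near_eq_Cinf_at _ _ _ (fun y =>
    \sum_(j < d) V y 0 j * local_tensor a x y (fun=> delta_mx 0 j))).
  apply: filterS (near_cinv cx Dx ma) => y my.
  by rewrite (linear_fun_sum (V y) (local_tensor1_linear my)).
by apply: Cinf_at_sum => j; apply: Cinf_atM; [exact: sV | exact: sa].
Qed.

Lemma Cinf_local2 (a : tensor_field N 2) x (V : 'rV[R]_d -> 'rV[R]_d) w :
  (forall v, Cinf_at (fun y => local_tensor a x y v : R) (coord x)) ->
  (\forall z \near x, multilinear (a z)) -> Cinf_at V (coord x) ->
  Cinf_at (fun y => local_tensor a x y (pair_of (V y) w) : R) (coord x).
Proof.
move=> sa ma /Cinf_at_rowP sV; have [cx Dx] := sN.1 x.
apply: (@near_eq_Cinf_at _ _ _ (fun y =>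
    \sum_(j < d) V y 0 j * local_tensor a x y (pair_of (delta_mx 0 j) w))).
  apply: filterS (near_cinv cx Dx ma) => y /multilinear2P [my _].
  rewrite (@linear_fun_sum _ _ (fun u => local_tensor a x y (pair_of u w)) (V y)) //.
  by move=> c u u'; rewrite !local_tensor_pair transition_linear my.
by apply: Cinf_at_sum => j; apply: Cinf_atM; [exact: sV | exact: sa].
Qed.

End LocalTensors.

(** * The infinitesimal generator and smoothness of the Liouville form *)

Section Generator.
Variables (R : realType) (e : nat) (P : charted R e) (h : R -> P -> P).
Hypothesis sP : smooth_charts P.
Let RP := prod_charted (real_line R) P.
Let hh : RP -> P := fun z => h z.1 z.2.
Hypothesis sh : smooth_on (M := RP) (@punctured R `*` setT) hh.
Hypothesis h1 : forall p, h 1 p = p.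

Lemma smooth_at_slice1 s p : s != 0 -> smooth_at (M := real_line R) (fun t => h t p) s.
Proof.
move=> s0; apply: (@smooth_at_comp _ _ _ _ (real_line R) RP P _ _ (fun t => (t, p)) hh).
- exact: real_line_good.
- by apply: prod_good; [exact: real_line_good | exact: sP.1].
- apply: smooth_at_pair; first exact: smooth_at_id (@real_line_good R) _.
  exact: smooth_at_cst.
- exact: sh.
Qed.

Lemma smooth_at_slice2 s p : s != 0 -> smooth_at (h s) p.
Proof.
move=> s0; apply: (@smooth_at_comp _ _ _ _ P RP P _ _ (fun q => (s, q)) hh).
- exact: sP.1.
- by apply: prod_good; [exact: real_line_good | exact: sP.1].
- apply: smooth_at_pair; last exact: smooth_at_id sP.1 _.
  exact: (@smooth_at_cst _ _ _ P (real_line R)).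
- exact: sh.
Qed.

(** The velocity of one orbit becomes a differential of the joint map [hh]. The point [p] now enters
    as the place of differentiation, which gives access to smoothness in [p]. *)
Lemma generatorE p : generator h p =
  tangent_map hh (1, p) (row_mx (const_mx 1 : 'rV[R]_1) 0).
Proof.
have gR := @real_line_good R.
have s1 : smooth_at (M := real_line R) (N := real_line R) id 1 by exact: smooth_at_id.
have s2 : smooth_at (M := real_line R) (N := P) (fun=> p) 1 by exact: smooth_at_cst.
have s3 := smooth_at_pair s1 s2.
have s4 : smooth_at hh (1, p) by apply: sh; split => //=; exact: oner_neq0.
rewrite /generator.
have := @tangent_map_comp _ _ _ _ (real_line R) RP P gR (prod_good gR sP.1)
  (fun t => (t, p)) hh 1 (const_mx 1) s3 s4.
rewrite /comp /hh /= => ->.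
rewrite (tangent_map_pair _ s1 s2) tangent_map_cst.
by rewrite (tangent_map_id gR).
Qed.

Definition local_generator (p : P) (y : 'rV[R]_e) : 'rV[R]_e :=
  'D_(row_mx (const_mx 1 : 'rV[R]_1) 0) (local_expr hh (1, p))
    (row_mx (const_mx 1 : 'rV[R]_1) y).

Lemma Cinf_at_row_const (y : 'rV[R]_e) :
  Cinf_at (fun y => row_mx (const_mx 1 : 'rV[R]_1) y) y.
Proof.
apply: (@Cinf_at_row_mx _ _ _ _ (fun=> const_mx 1) id); first exact: Cinf_at_cst.
exact: Cinf_at_id.
Qed.

Lemma Cinf_local_generator p : Cinf_at (local_generator p) (coord p).
Proof.
have [_ s4] : smooth_at hh (1, p) by apply: sh; split => //=; exact: oner_neq0.
have := Cinf_at_derive (row_mx (const_mx 1 : 'rV[R]_1) 0) s4.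
exact: (Cinf_at_comp (Cinf_at_row_const (coord p))).
Qed.

(** This is [tangent_map_transition] for the action at [(1, p)], along the points [(1, y)] and in
    the direction of the group factor. *)
Lemma near_generator p : \forall y \near coord p,
  generator h (cinv (chart_at p) y) = transition p y (local_generator p y).
Proof.
have [cp Dp] := sP.1 p.
have sRP : smooth_charts RP by apply: prod_smooth_charts => //; exact: real_line_charts.
have s4 : smooth_at hh (1, p) by apply: sh; split => //=; exact: oner_neq0.
have T := tangent_map_transition sRP sP s4.
have cr := Cinf_at_continuous (Cinf_at_row_const (coord p)).
have n1 := near_continuous cr T.
have n2 := near_continuous cr (Cinf_at_near s4.2).
apply: filterS3 n1 n2 (near_cim cp Dp) => y /= Ty dy Iy0.
have Iy : (cmap (chart_at p) @` cdom (chart_at p)) y := Iy0.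
set z := cinv (chart_at p) y; set Y := row_mx _ _ in Ty dy.
have EY : cinv (chart_at ((1, p) : RP)) Y = (1, z).
  by rewrite /= row_mxKl row_mxKr mxE.
have sz : smooth_at hh (1, z) by apply: sh; split => //=; exact: oner_neq0.
have EY' : (lsubmx Y ord0 ord0, cinv (chart_at p) (rsubmx Y)) = (1, z) := EY.
rewrite generatorE; move: (Ty); rewrite EY' => /(_ sz (row_mx (const_mx 1 : 'rV[R]_1) 0)).
have -> : local_expr hh (1, p) Y = y.
  rewrite /local_expr /= row_mxKl row_mxKr mxE /hh /= !h1.
  exact: (cmapK cp Iy).
have -> : hh (1, p) = p by rewrite /hh /= h1.
rewrite -/(local_generator p y).
have -> : 'd (local_expr hh (1, p)) Y (row_mx (const_mx 1 : 'rV[R]_1) 0) = local_generator p y.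
  by rewrite /local_generator deriveE.
move=> <-; congr (tangent_map hh (1, z) _).
rewrite /transition EY.
have dA : differentiable (cmap (chart_at z) \o cinv (chart_at p)) y.
  rewrite -[X in differentiable _ X](cmapK cp Iy).
  apply: Cinf_at_diff; apply: sP.2; first exact: cdom_cinv.
  exact: (sP.1 z).2.
pose L : {linear 'rV[R]_(1 + e) -> 'rV[R]_1} := lsubmx.
pose L' : {linear 'rV[R]_(1 + e) -> 'rV[R]_e} := rsubmx.
have dL : differentiable L Y by exact: Cinf_at_diff (Cinf_at_linear _ _).
have dL' : differentiable L' Y by exact: Cinf_at_diff (Cinf_at_linear _ _).
have EL' : L' Y = y by rewrite /L' /= row_mxKr.
have dA' : differentiable (cmap (chart_at z) \o cinv (chart_at p)) (L' Y) by rewrite EL'.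
(* The change of product charts is the identity on the group factor, and its other component does
   not depend on that factor; hence its differential fixes the group direction. *)
have E : cmap (chart_at ((1, z) : RP)) \o cinv (chart_at ((1, p) : RP)) =
    (fun Y' => row_mx (L Y') (((cmap (chart_at z) \o cinv (chart_at p)) \o L') Y')).
  apply/funext => Y' /=; congr row_mx.
  by apply/rowP => i; rewrite (ord1 i) mxE.
apply/esym/(etrans (congr1 (fun k => 'd k Y _) E)).
apply: (etrans (diff_row_mx _ dL (differentiable_comp dL' dA'))).
congr row_mx.
  apply: (etrans (congr1 (@^~ _) (diff_linear_rV L Y))).
  by rewrite /L /= row_mxKl.
apply: (etrans (congr1 (@^~ _) (diff_comp dL' dA'))).
rewrite /=; apply: (etrans (congr1 ('d _ (L' Y)) (congr1 (@^~ _) (diff_linear_rV L' Y)))).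
by rewrite /L' /= row_mxKr linear0.
Qed.

Lemma liouville_smooth (w : tensor_field P 2) :
  smooth_tensor_on setT w -> smooth_tensor_on setT (liouville h w).
Proof.
move=> sw.
have lE p v : liouville h w p v = w p (pair_of (generator h p) (v ord0)).
  rewrite /liouville /contract; congr (w p _); rewrite [LHS]pair_ofE.
  by rewrite unlift_none liftK.
have mw p : multilinear (w p) by have [] := sw p I.
move=> p _; split.
  apply/multilinear1P => c u u'; rewrite !lE.
  by have [_ ->] := (multilinear2P (w p)).1 (mw p).
move=> v.
apply: (@near_eq_Cinf_at _ _ _ (fun y =>
    local_tensor w p y (pair_of (local_generator p y) (v ord0)))).
  apply: filterS (near_generator p) => y Ey.
  by rewrite local_tensor_pair /local_tensor lE Ey.
apply: Cinf_local2 => //; [by have [] := sw p I | exact: nearW |].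
exact: Cinf_local_generator.
Qed.

End Generator.

(** * Duality with respect to a Riemannian metric *)

Section Metric.
Variables (R : realType) (d : nat).
Implicit Types (g : tensor R d 2) (xi : 'rV[R]_d -> R).

Definition gram g : 'M[R]_d :=
  \matrix_(i, j) g (pair_of (delta_mx 0 i) (delta_mx 0 j)).

Lemma pair_gram g u v : multilinear g ->
  g (pair_of u v) = (u *m gram g *m v^T) 0 0.
Proof.
move=> /multilinear2P [gl gr].
rewrite (linear_fun_sum u (gl v)) -mulmxA mxE; apply: eq_bigr => i _.
rewrite (linear_fun_sum v (gr (delta_mx 0 i))) mxE; congr (_ * _).
by apply: eq_bigr => j _; rewrite !mxE mulrC.
Qed.

Lemma gram_unit g : multilinear g -> (forall v, v != 0 -> 0 < g (pair_of v v)) ->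
  gram g \in unitmx.
Proof.
move=> mg pg; rewrite -row_free_unit; apply/inj_row_free => v vG.
apply/eqP; apply: contraT => /pg; rewrite pair_gram // vG mul0mx mxE.
by rewrite ltxx.
Qed.

(** The vector representing [xi] through [g], given by the inverse Gram matrix instead of a choice,
    so that its smooth dependence on [g] and [xi] can be read off. *)
Definition riesz g xi : 'rV[R]_d := (\row_i xi (delta_mx 0 i)) *m invmx (gram g).

Lemma rieszE g xi u : multilinear g -> gram g \in unitmx -> linear_fun xi ->
  g (pair_of (riesz g xi) u) = xi u.
Proof.
move=> mg ug lx; rewrite pair_gram // /riesz mulmxKV // mxE (linear_fun_sum u lx).
by apply: eq_bigr => i _; rewrite !mxE mulrC.
Qed.

Lemma riesz_unique g xi v : multilinear g ->
  (forall v, v != 0 -> 0 < g (pair_of v v)) -> linear_fun xi ->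
  (forall u, g (pair_of v u) = xi u) -> v = riesz g xi.
Proof.
move=> mg pg lx H; apply/eqP; rewrite -subr_eq0; apply: contraT => /pg.
have [gl _] := (multilinear2P g).1 mg.
rewrite (linear_funB v (riesz g xi) (gl _)) H (rieszE _ mg) //.
  by rewrite subrr ltxx.
exact: gram_unit.
Qed.

(* With [v0] the vector dual to [xi], both sides are the dual norm of [xi]. *)
Lemma dual_norm g xi v0 v : multilinear g ->
  (forall u v, g (pair_of u v) = g (pair_of v u)) ->
  (forall v, v != 0 -> 0 < g (pair_of v v)) -> linear_fun xi ->
  (forall u, g (pair_of v0 u) = xi u) -> v != 0 ->
  (forall u, xi u = 0 -> g (pair_of v u) = 0) ->
  Num.sqrt (xi v0) = `|xi v| / Num.sqrt (g (pair_of v v)).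
Proof.
move=> mg sg pg lx H v0' kv.
have gv0 := pg _ v0'; have [gl gr] := (multilinear2P g).1 mg.
have xv0 : xi v != 0.
  by apply: contraTneq gv0 => /kv ->; rewrite ltxx.
have := linear_fun_proportional lx (gr v) xv0 kv v0.
rewrite sg H => E.
(* Equality case of Cauchy-Schwarz: a vector orthogonal to the kernel of [xi] is proportional to
   [v0]. *)
have E2 : xi v ^+ 2 = xi v0 * g (pair_of v v).
  by rewrite expr2 {1}E [_ * xi v0]mulrC !mulrA divfK.
have x0 : 0 <= xi v0.
  by rewrite -(pmulr_lge0 _ gv0) -E2 sqr_ge0.
by rewrite -sqrtr_sqr E2 sqrtrM // mulfK // gt_eqF // sqrtr_gt0.
Qed.

End Metric.

Section DualNorm.
Variables (R : realType) (d : nat) (M : charted R d).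
Hypothesis sM : smooth_charts M.
Variables (g : tensor_field M 2) (eta : tensor_field M 1) (x : M).
Hypothesis rg : riemannian g.
Hypothesis seta : forall v, Cinf_at (fun y => local_tensor eta x y v : R) (coord x).
Hypothesis meta : \forall z \near x, multilinear (eta z).

(* The squared norm of [eta z] for the metric dual to [g z]. *)
Definition dual_sq (z : M) : R :=
  eta z (fun=> riesz (g z) (fun u => eta z (fun=> u))).

Let mg z : multilinear (g z).
Proof. by have [sg _ _] := rg; have [] := sg z I. Qed.

Let mlg y : multilinear (local_tensor g x y).
Proof.
have [gl gr] := (multilinear2P _).1 (mg (cinv (chart_at x) y)).
apply/multilinear2P; split=> [v|u] c a b; rewrite !local_tensor_pair.
  by rewrite transition_linear gl.
by rewrite transition_linear gr.
Qed.

Lemma smooth_dual_sq : smooth_real dual_sq x.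
Proof.
have [cx Dx] := sM.1 x; have [sg _ pg] := rg.
apply/(smooth_realP sM.1).
pose r y := riesz (local_tensor g x y) (fun u => local_tensor eta x y (fun=> u)).
have CG i j : Cinf_at (fun y => gram (local_tensor g x y) i j : R) (coord x).
  have [_ /(_ (pair_of (delta_mx 0 i) (delta_mx 0 j)))] := sg x I.
  by apply: eq_Cinf_at => y; rewrite mxE.
have uG : gram (local_tensor g x (coord x)) \in unitmx.
  apply: gram_unit => // v v0.
  by rewrite local_tensor_coord //; exact: pg.
have nG : \forall y \near coord x, gram (local_tensor g x y) \in unitmx.
  have Hd := Cinf_at_det CG.
  have d0 : \det (gram (local_tensor g x (coord x))) != 0 by rewrite -unitfE -unitmxE.
  apply: filterS (continuous_near_open (Cinf_at_continuous Hd) (@open_neq R 0) d0).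
  by move=> y /=; rewrite unitmxE unitfE.
have Cr : Cinf_at r (coord x).
  apply/Cinf_at_rowP => j.
  apply: (@eq_Cinf_at _ _ _ (fun y => \sum_(i < d)
      local_tensor eta x y (fun=> delta_mx 0 i) * invmx (gram (local_tensor g x y)) i j)).
    by move=> y; rewrite /r /riesz !mxE; apply: eq_bigr => i _; rewrite !mxE.
  apply: Cinf_at_sum => i; apply: Cinf_atM; first exact: seta.
  exact: (Cinf_at_invmx CG uG).
apply: near_eq_Cinf_at (Cinf_local1 sM seta meta Cr).
apply: filterS3 nG (near_cinv cx Dx meta) (near_cim cx Dx) => y uGy my Iy.
set z := cinv (chart_at x) y in my *.
have lz : linear_fun (fun u => eta z (fun=> u)) by apply/multilinear1P.
(* The dual vector at [z] is recognized by its pairings with all vectors, and by [transition_surj]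
   each of these comes from the fixed chart at [x]. *)
suff E : transition x y (r y) = riesz (g z) (fun u => eta z (fun=> u)).
  by rewrite /dual_sq -E.
apply: riesz_unique => // [|u]; first exact: pg.
have [u' <-] := transition_surj sM Iy u.
rewrite -local_tensor_pair rieszE //.
exact: local_tensor1_linear.
Qed.

End DualNorm.

Section Ratio.
Variables (R : realType) (d e : nat) (P : charted R e) (M : charted R d).
Hypotheses (sP : smooth_charts P) (sM : smooth_charts M).
Variables (tau : P -> M) (theta : tensor_field P 1) (eta : tensor_field M 1).
Hypothesis st : smooth_on setT tau.

(** On the constant coordinate vector [u0] both forms give smooth functions in fixed charts, and the
    denominator stays nonzero near [p]. This suits a [lam] known only through the proportionality it
    satisfies. *)
Lemma smooth_ratio (lam : P -> R) p u0 :
  (forall v, Cinf_at (fun y => local_tensor theta p y v : R) (coord p)) ->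
  (forall v, Cinf_at (fun y => local_tensor eta (tau p) y v : R) (coord (tau p))) ->
  (\forall z \near tau p, multilinear (eta z)) ->
  (\forall q \near p, forall u, theta q (fun=> u) =
     lam q * eta (tau q) (fun=> tangent_map tau q u)) ->
  eta (tau p) (fun=> tangent_map tau p u0) != 0 -> smooth_real lam p.
Proof.
move=> sth set meta nlam u00; have [cp Dp] := sP.1 p.
have stp := st (x := p) I; have [ct lt] := stp.
have [cx Dx] := sM.1 (tau p).
pose F := local_expr tau p; pose V y := 'D_u0 F y.
have EF : F (coord p) = coord (tau p) by rewrite /F local_expr_coord //; exact: sP.1.
pose D y := local_tensor eta (tau p) (F y) (fun=> V y).
have CV : Cinf_at V (coord p) by exact: Cinf_at_derive.
have nm : \forall y \near coord p, multilinear (eta (cinv (chart_at (tau p)) (F y))).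
  have := near_cinv cx Dx meta; rewrite -[cmap _ _]EF.
  exact: (near_continuous (Cinf_at_continuous lt)).
have CD : Cinf_at (D : _ -> R) (coord p).
  apply: (@near_eq_Cinf_at _ _ _ (fun y => \sum_(i < d)
      V y 0 i * local_tensor eta (tau p) (F y) (fun=> delta_mx 0 i))).
    apply: filterS nm => y my.
    by rewrite /D (linear_fun_sum (V y) (local_tensor1_linear my)).
  apply: Cinf_at_sum => i; apply: Cinf_atM.
    exact: (Cinf_at_rowP V (coord p)).1.
  apply: (@Cinf_at_comp_real _ _ _ F
    (fun y => local_tensor eta (tau p) y (fun=> delta_mx 0 i)) _ lt).
  by rewrite EF; exact: set.
have D0 : D (coord p) != 0.
  rewrite /D EF local_tensor_coord //.
  by rewrite /V deriveE //; exact: Cinf_at_diff lt.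
apply/(smooth_realP sP.1).
have CQ := Cinf_atM (sth (fun=> u0)) (Cinf_atV D0 CD).
apply: near_eq_Cinf_at CQ.
have T := tangent_map_transition sP sM stp.
have nD := continuous_near_open (Cinf_at_continuous CD) (@open_neq R 0) D0.
have n2 : \forall y \near coord p, cdom (chart_at (tau p)) (tau (cinv (chart_at p) y)).
  have := near_continuous ct (near_cdom cx Dx).
  exact: near_cinv.
have FF : Filter (nbhs (coord p)) by exact: nbhs_filter.
have n1 : nbhs (coord p) (_ `&` _) := filterI (near_cinv cp Dp nlam) (Cinf_at_near lt).
have n3 : nbhs (coord p) (_ `&` _) := filterI T nD.
apply: filterS3 (n1 FF) n2 (n3 FF) => y [lamy dy] Dt [Ty Dy].
set z := cinv (chart_at p) y in Ty lamy Dt *.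
have Ez : cinv (chart_at (tau p)) (F y) = tau z by rewrite /F /local_expr /= (cinvK cx).
have -> : local_tensor theta p y (fun=> u0) = lam z * D y.
  rewrite /local_tensor -/z -[X in theta z X]/(fun=> transition p y u0) lamy.
  rewrite Ty; last exact: st.
  by rewrite /D /local_tensor Ez /V (deriveE u0 dy) /transition Ez.
by rewrite mulfK.
Qed.

End Ratio.

(** * Exterior derivative of a 1-form *)

Section ExteriorDerivative.
Variables (R : realType) (d : nat).

(** The derivative along [u] of [a(w)], for fields constant in the chart at [x]. Such fields
    commute, so antisymmetrizing gives the exterior derivative without a bracket term. *)
Definition pair_deriv (N : charted R d) (a : tensor_field N 1) (x : N) (u w : 'rV[R]_d) : R :=
  'D_u (fun y => local_tensor a x y (fun=> w) : R) (coord x).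

Lemma ext_deriv1E (N : charted R d) (a : tensor_field N 1) (x : N) v :
  ext_deriv a x v = pair_deriv a x (v ord0) (v (lift ord0 ord0)) -
    pair_deriv a x (v (lift ord0 ord0)) (v ord0).
Proof.
rewrite /ext_deriv big_ord_recl big_ord1 /= expr0 mul1r expr1 mulN1r.
have -> : (fun j : 'I_1 => v (lift ord0 j)) = (fun=> v (lift ord0 ord0)).
  by apply/funext => j; rewrite (ord1 j).
have -> : (fun j : 'I_1 => v (lift (lift ord0 ord0) j)) = (fun=> v ord0).
  by apply/funext => j; rewrite (ord1 j); congr v; apply/val_inj.
by [].
Qed.

Lemma multilinear_ext_deriv1 (N : charted R d) (a : tensor_field N 1) (x : N) :
  smooth_charts N -> (\forall z \near x, multilinear (a z)) ->
  (forall v, Cinf_at (fun y => local_tensor a x y v : R) (coord x)) ->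
  multilinear (ext_deriv a x).
Proof.
move=> sN ma sa; have [cx Dx] := sN.1 x.
have da w := Cinf_at_diff (sa (fun=> w)).
have lw u : linear_fun (pair_deriv a x u).
  move=> c w w'; rewrite /pair_deriv.
  pose f w := fun y => local_tensor a x y (fun=> w) : R.
  have E : {near coord x, (c *: f w + f w') =1 f (c *: w + w')}.
    apply: filterS (near_cinv cx Dx ma) => y my.
    by rewrite /f (local_tensor1_linear my).
  have := near_eq_derive u E.
  rewrite /f => <-; rewrite deriveD ?deriveZ //.
  - exact/diff_derivable/da.
  - exact/derivableZ/diff_derivable/da.
  - exact/diff_derivable/da.
have lu w : linear_fun (fun u => pair_deriv a x u w).
  by move=> c u u'; rewrite /pair_deriv !(deriveE _ (da w)) linearP.
have E u v : ext_deriv a x (pair_of u v) = pair_deriv a x u v - pair_deriv a x v u.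
  exact: ext_deriv1E.
have lr u c w w' : pair_deriv a x u (c *: w + w') =
  c * pair_deriv a x u w + pair_deriv a x u w' := lw u c w w'.
have ll u c w w' : pair_deriv a x (c *: w + w') u =
  c * pair_deriv a x w u + pair_deriv a x w' u := lu u c w w'.
have alg (c A B A' B' : R) : c * A + B - (c * A' + B') = c * (A - A') + (B - B').
  by rewrite mulrBr opprD addrACA.
apply: (multilinear2P (ext_deriv a x)).2; split=> [v|u] c w w'.
  rewrite (E (c *: w + w')) (E w) (E w') (lr v c w w') (ll v c w w').
  exact: alg.
rewrite (E u (c *: w + w')) (E u w) (E u w') (lr u c w w') (ll u c w w').
exact: alg.
Qed.

(* [d(L a) = L da + dL /\ a], and the last term vanishes on [ker a]. *)
Lemma ext_deriv1_rescale (N N' : charted R d) (a : tensor_field N 1)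
    (a' : tensor_field N' 1) (x : N) (x' : N') (L : 'rV[R]_d -> R) w :
  smooth_charts N -> coord x' = coord x ->
  (forall v, Cinf_at (fun y => local_tensor a x y v : R) (coord x)) ->
  Cinf_at L (coord x) ->
  (\forall y \near coord x, forall v,
     local_tensor a' x' y v = L y * local_tensor a x y v) ->
  (forall i, a x (fun=> w i) = 0) ->
  ext_deriv a' x' w = L (coord x) * ext_deriv a x w.
Proof.
move=> sN Ec sa CL nE kw.
have pd i j : pair_deriv a' x' (w i) (w j) = L (coord x) * pair_deriv a x (w i) (w j).
  rewrite /pair_deriv Ec.
  pose f := fun y => local_tensor a x y (fun=> w j) : R.
  have E : {near coord x, L * f =1 fun y => local_tensor a' x' y (fun=> w j)}.
    by apply: filterS nE => y ->.
  have df : derivable f (coord x) (w i) by exact/diff_derivable/(Cinf_at_diff (sa _)).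
  have dL : derivable L (coord x) (w i) by exact/diff_derivable/(Cinf_at_diff CL).
  have <- := near_eq_derive (w i) E.
  rewrite (deriveM dL df) /f (local_tensor_coord sN) kw.
  by rewrite scale0r addr0.
by rewrite !ext_deriv1E !pd mulrBr.
Qed.

End ExteriorDerivative.

(** * The covector of a point of the cover *)

Lemma riesz_scale (R : realType) (d : nat) (g : tensor R d 2) (xi xi' : 'rV[R]_d -> R) c :
  (forall u, xi' u = c * xi u) -> riesz g xi' = c *: riesz g xi.
Proof.
move=> E; rewrite /riesz scalemxAl; congr (_ *m _).
by apply/rowP => i; rewrite !mxE E.
Qed.

(** Rank-nullity: surjectivity makes the rank [m], hence the kernel a line, spanned by any of its
    nonzero vectors. *)
Lemma kernel_line (R : fieldType) (m : nat) (A : 'M[R]_(m.+1, m)) (w : 'rV[R]_m.+1) :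
  (forall y : 'rV[R]_m, exists u, u *m A = y) -> w != 0 -> w *m A = 0 ->
  forall u, u *m A = 0 -> exists c, u = c *: w.
Proof.
move=> sA w0 wA u uA.
have fA : \rank A = m.
  apply/eqP; rewrite -[_ == _]/(row_full A) -sub1mx; apply/row_subP => i.
  by have [v <-] := sA (row i 1%:M); rewrite submxMl.
have rK : \rank (kermx A) = 1 by rewrite mxrank_ker fA subSnn.
have wK : (w <= kermx A)%MS by apply/sub_kermxP.
have uK : (u <= kermx A)%MS by apply/sub_kermxP.
apply/sub_rVP; apply: submx_trans uK _.
by rewrite -(geq_leqif (mxrank_leqif_sup wK)) rK rank_rV w0.
Qed.

Section SymplecticCover.
Variables (R : realType) (n : nat).
Variables (M : charted R n.*2.+1) (C : M -> {vspace 'rV[R]_(n.*2.+1)}).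
Variables (P : charted R n.*2.+2) (tau : P -> M) (h : R -> P -> P).
Variable omega : tensor_field P 2.
Hypotheses (hM : contact_manifold C) (hP : symplectic_cover tau h C omega).

Let theta := liouville h omega.

Lemma base_charts : smooth_charts M.
Proof. by have [sM _ _] := hM; exact: smooth_manifold_charts. Qed.

Let bundle : principal_bundle tau h.
Proof. by have [[]] := hP. Qed.

Lemma total_charts : smooth_charts P.
Proof. by have [[sP _ _] _ _ _] := bundle; exact: smooth_manifold_charts. Qed.

Let gdM : good_charts M := base_charts.1.
Let gdP : good_charts P := total_charts.1.
Let gdR : good_charts (real_line R) := @real_line_good R.

Lemma proj_smooth p : smooth_at tau p.
Proof. by have [[_ _ st] _ _ _] := bundle; exact: st. Qed.

Lemma action_smooth : smooth_on (M := prod_charted (real_line R) P)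
  (@punctured R `*` setT) (fun z => h z.1 z.2).
Proof. by have [_ [sh _ _] _ _] := bundle. Qed.

Lemma action1 p : h 1 p = p.
Proof. by have [_ [_ h1 _] _ _] := bundle. Qed.

Lemma action_comp s t p : s != 0 -> t != 0 -> h s (h t p) = h (s * t) p.
Proof. by have [_ [_ _ hc] _ _] := bundle; exact: hc. Qed.

Lemma proj_action s p : s != 0 -> tau (h s p) = tau p.
Proof. by have [_ _ ht _] := bundle; exact: ht. Qed.

Lemma smooth_action s p : s != 0 -> smooth_at (h s) p.
Proof. exact: (smooth_at_slice2 total_charts action_smooth). Qed.

Lemma smooth_orbit s p : s != 0 -> smooth_at (M := real_line R) (fun t => h t p) s.
Proof. exact: (smooth_at_slice1 total_charts action_smooth). Qed.

Lemma local_section x : exists (U : set M) (sg : M -> P) (rho : P -> R),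
  [/\ open U, U x, smooth_on U sg & forall x', U x' -> tau (sg x') = x'] /\
  [/\ forall p, U (tau p) -> smooth_real rho p,
      forall p, U (tau p) -> rho p != 0,
      forall p, U (tau p) -> h (rho p) (sg (tau p)) = p
    & forall s p, s != 0 -> U (tau p) -> rho (h s p) = s * rho p].
Proof.
have [_ _ _ /(_ x) [U [psi [psi' [oU Ux [s1 s2 K1 K2] E1 E2]]]]] := bundle.
pose MR := prod_charted M (real_line R).
have gdMR : good_charts MR by exact: prod_good.
exists U, (fun x' => psi' (x', 1)), (fun p => (psi p).2).
have p1 x' : U x' -> (U `*` @punctured R) (x', 1).
  by move=> Ux'; split => //=; exact: oner_neq0.
have ts x' : U x' -> tau (psi' (x', 1)) = x'.
  by move=> /p1/K2 [/= Ut Kz]; rewrite -E1 // Kz.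
split; split; [exact: oU | exact: Ux | | exact: ts | | | | by move=> s p s0; exact: E2].
- move=> x' Ux'; apply: (@smooth_at_comp _ _ _ _ M MR P gdM gdMR (fun y => (y, 1)) psi').
    apply: smooth_at_pair; first exact: smooth_at_id.
    exact: (@smooth_at_cst _ _ _ M (real_line R)).
  exact/s2/p1.
- move=> p Up.
  apply: (@smooth_at_comp _ _ _ _ P MR (real_line R) gdP gdMR psi snd).
    exact: s1.
  exact: (smooth_at_snd gdM gdR).
- by move=> p /K1 [[]].
- move=> p Up; have [[_ rp0] Kp] := K1 _ Up.
  have Us : U (tau (psi' (tau p, 1))) by rewrite ts.
  have Uh : U (tau (h (psi p).2 (psi' (tau p, 1)))) by rewrite proj_action.
  (* Both points have the same image under [psi], which is injective over [U] because [psi'] inverts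
     it. *)
  have [_ Kh] := K1 _ Uh; rewrite -Kh -[RHS]Kp; congr psi'.
  rewrite [LHS]surjective_pairing [RHS]surjective_pairing E1 // proj_action // ts //.
  rewrite E1 // E2 //; congr (_, _).
  by have [_ ->] := K2 _ (p1 _ Up); rewrite mulr1.
Qed.

Lemma tangent_proj_surj p w : exists u, tangent_map tau p u = w.
Proof.
have [U [sg [rho [[oU Up ss ts] [_ r0 Kr _]]]]] := local_section (tau p).
(* The section [sg] may miss [p]; acting by the constant [rho p] moves it to one through [p]. *)
pose s := h (rho p) \o sg.
have sm : smooth_at s (tau p).
  by apply: smooth_at_comp => //; [exact: ss | exact/smooth_action/r0].
have sp : s (tau p) = p by exact: Kr.
exists (tangent_map s (tau p) w).
have nid : {near tau p, id =1 tau \o s}.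
  apply: filterS (open_nbhs_nbhs (conj oU Up)) => x' Ux'.
  by rewrite /= proj_action ?ts // r0.
have := near_tangent_map gdM nid (smooth_at_id gdM _) w.
rewrite (tangent_map_id gdM) => E.
by rewrite -[RHS]E (tangent_map_comp gdM gdP w sm (proj_smooth _)) sp.
Qed.

Lemma tangent_proj_generator p : tangent_map tau p (generator h p) = 0.
Proof.
have so := smooth_orbit p (oner_neq0 R).
have := tangent_map_comp gdR gdP (const_mx 1) so (proj_smooth (h 1 p)).
rewrite [h 1 p]action1 -/(generator h p) => <-.
(* Staying near [1] avoids [h 0], whose values are arbitrary. *)
have nc : {near (1 : R), (fun=> tau p) =1 tau \o (fun t => h t p)}.
  have : \forall t \near (1 : R), t != 0.
    by apply: open_nbhs_nbhs; split; [exact: open_neq | exact: oner_neq0].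
  by apply: filterS => t t0; rewrite /= proj_action.
rewrite (near_tangent_map gdR nc); first exact: (tangent_map_cst (N := real_line R)).
exact: (smooth_at_cst (N := real_line R)).
Qed.

(** Along the orbit the fibre coordinate is [t * rho p], whose derivative [rho p] is nonzero. *)
Lemma generator_neq0 p : generator h p != 0.
Proof.
have [U [sg [rho [[oU Up ss ts] [sr r0 Kr Er]]]]] := local_section (tau p).
have so := smooth_orbit p (oner_neq0 R).
have U1 : U (tau (h 1 p)) by rewrite action1.
have := @tangent_map_comp _ _ _ _ (real_line R) P (real_line R) gdR gdP
  (fun t => h t p) rho 1 (const_mx 1) so (sr _ U1).
rewrite [h 1 p]action1 -/(generator h p) => E.
apply/eqP => g0; move: E; rewrite g0 /tangent_map linear0.
have nc : {near (1 : R), rho \o (fun t => h t p) =1 (fun t => t * rho p)}.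
  have : \forall t \near (1 : R), t != 0.
    by apply: open_nbhs_nbhs; split; [exact: open_neq | exact: oner_neq0].
  by apply: filterS => t t0; rewrite /= Er.
have sc : smooth_at (M := real_line R) (N := real_line R) (rho \o (fun t => h t p)) 1.
  exact: (@smooth_at_comp _ _ _ _ (real_line R) P (real_line R) gdR gdP _ _ _ so (sr _ U1)).
have := near_tangent_map (N := real_line R) (N' := real_line R) gdR nc sc (const_mx 1).
rewrite -/(tangent_map _ _ _) => <- H.
pose L : {linear 'rV[R]_1 -> 'rV[R]_1} := *:%R (rho p).
have EL : local_expr (M := real_line R) (N := real_line R) (fun t => t * rho p) 1 = L.
  apply/funext => y; apply/rowP => i.
  by rewrite /local_expr /= !mxE (ord1 i) mulrC.
have : L (const_mx 1) = 0.
  rewrite -[RHS]H; apply: esym; apply: (etrans (congr1 (fun k => 'd k _ _) EL)).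
  exact: (congr1 (@^~ _) (diff_linear_rV L _)).
move/rowP => /(_ 0); rewrite !mxE mulr1 => /eqP.
by rewrite (negPf (r0 _ Up)).
Qed.

Lemma tangent_proj_ker p u : tangent_map tau p u = 0 ->
  exists c, u = c *: generator h p.
Proof.
pose A := lin1_mx ('d (local_expr tau p) (coord p)).
have EA v : v *m A = tangent_map tau p v by rewrite mul_rV_lin1.
rewrite -EA; apply: (kernel_line (A := A)).
- by move=> y; have [v <-] := tangent_proj_surj p y; exists v; rewrite EA.
- exact: generator_neq0.
- by rewrite EA; exact: tangent_proj_generator.
Qed.

Lemma omega_form : form_on setT omega.
Proof. by have [[_ [] ]] := hP. Qed.

Lemma liouvilleE p u : theta p (fun=> u) = omega p (pair_of (generator h p) u).
Proof.
rewrite /theta /liouville /contract; congr (omega p _).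
by rewrite [LHS]pair_ofE unlift_none liftK.
Qed.

Lemma liouville_form : smooth_tensor_on setT theta.
Proof.
by apply: (liouville_smooth total_charts action_smooth action1); have [] := omega_form.
Qed.

Lemma liouville_linear p : linear_fun (fun u => theta p (fun=> u)).
Proof. by apply/multilinear1P; have [] := liouville_form (x := p) I. Qed.

Lemma liouville_vertical p u : tangent_map tau p u = 0 -> theta p (fun=> u) = 0.
Proof.
move=> /tangent_proj_ker [c ->].
rewrite (linear_funZ c _ (liouville_linear p)) liouvilleE.
have [_ aw] := omega_form.
by rewrite (aw p I _ ord0 (lift ord0 ord0)) ?mulr0 // /pair_of eqxx.
Qed.

(* By [liouville_vertical] the choice of a lift is immaterial, see [PhiE]. *)
Definition Phi (p : P) (w : 'rV[R]_(n.*2.+1)) : R :=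
  theta p (fun=> projT1 (cid (tangent_proj_surj p w))).

Lemma PhiE p u : Phi p (tangent_map tau p u) = theta p (fun=> u).
Proof.
rewrite /Phi; case: cid => v /= Ev; apply/eqP; rewrite -subr_eq0.
rewrite -(linear_funB _ _ (liouville_linear p)); apply/eqP/liouville_vertical.
by rewrite /tangent_map linearB -![('d _ _) _]/(tangent_map tau p _) Ev subrr.
Qed.

Lemma Phi_linear p : linear_fun (Phi p).
Proof.
move=> c w w'.
have [u <-] := tangent_proj_surj p w; have [u' <-] := tangent_proj_surj p w'.
have <- : tangent_map tau p (c *: u + u') =
    c *: tangent_map tau p u + tangent_map tau p u' by exact: tangent_map_linear.
by rewrite !PhiE (liouville_linear p).
Qed.

(** If the covector vanished, the nonzero generator would be [omega]-orthogonal to every vector,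
    against nondegeneracy. *)
Lemma Phi_neq0 p : exists w, Phi p w != 0.
Proof.
apply: contrapT => H; have /eqP := generator_neq0 p; apply.
have [[_ [_ _ nd] _] _] := hP; apply: (nd p) => v.
rewrite -liouvilleE -PhiE; apply: contrapT => /eqP nz.
by apply: H; exists (tangent_map tau p v).
Qed.

(** The cover condition collects kernels over a whole fibre, so at a given [p] it yields directly
    only that the kernel of [Phi p] lies in [C]. The dimension of [C] does the rest. *)
Lemma Phi_ker p w : w \in C (tau p) <-> Phi p w = 0.
Proof.
apply: hyperplane_kernel; first exact: Phi_linear.
  by have [_ dC _] := hM; rewrite dC.
move=> v Pv; have [_ /(_ (tau p)) HC] := hP.
have [u Eu] := tangent_proj_surj p v.
have : [set v | v \in C (tau p)] v.
  rewrite -HC; exists p; split=> //; exists u => //.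
  by rewrite /kernel1 /= -/theta -PhiE Eu.
by [].
Qed.

(** The group is commutative, so [h s] carries the orbit of [p] to that of [h s p] with the same
    parameter. *)
Lemma generator_action s p : s != 0 ->
  tangent_map (h s) p (generator h p) = generator h (h s p).
Proof.
move=> s0; have so := smooth_orbit p (oner_neq0 R).
have := tangent_map_comp gdR gdP (const_mx 1) so (smooth_action (h 1 p) s0).
rewrite [h 1 p]action1 -/(generator h p) => <-.
have nc : {near (1 : R), (fun t => h t (h s p)) =1 h s \o (fun t => h t p)}.
  have : \forall t \near (1 : R), t != 0.
    by apply: open_nbhs_nbhs; split; [exact: open_neq | exact: oner_neq0].
  by apply: filterS => t t0; rewrite /= !action_comp // mulrC.
exact: (near_tangent_map (N := real_line R) gdR nc (smooth_orbit _ (oner_neq0 R))).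
Qed.

(** [h s] preserves the projection and the generator and multiplies [omega] by [s], so only this
    factor remains. *)
Lemma Phi_action s p w : s != 0 -> Phi (h s p) w = s * Phi p w :> R.
Proof.
move=> s0; have [u <-] := tangent_proj_surj p w.
have E : tangent_map tau p u = tangent_map tau (h s p) (tangent_map (h s) p u).
  rewrite -(tangent_map_comp gdP gdP u (smooth_action p s0) (proj_smooth _)).
  have nc : {near p, tau =1 tau \o h s}.
    by apply: nearW => q; rewrite /= proj_action.
  by rewrite (near_tangent_map gdP nc (proj_smooth p)).
rewrite PhiE E PhiE !liouvilleE -generator_action //.
have [[_ _ /(_ s s0 p (pair_of (generator h p) u)) <-] _] := hP.
rewrite /pullback; congr (omega _ _); apply/funext => i.
by rewrite /pair_of; case: (i == ord0).
Qed.

End SymplecticCover.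

(** * The metric calibration *)

Section Calibration.
Variables (R : realType) (n : nat).
Variables (M : charted R n.*2.+1) (C : M -> {vspace 'rV[R]_(n.*2.+1)}).
Variables (P : charted R n.*2.+2) (tau : P -> M) (h : R -> P -> P).
Variables (omega : tensor_field P 2) (gM : tensor_field M 2).
Hypotheses (hM : contact_manifold C) (hP : symplectic_cover tau h C omega).
Hypothesis hg : riemannian gM.

Local Notation phi := (Phi hM hP).
Let gdM : good_charts M := (base_charts hM).1.
Let gdP : good_charts P := (total_charts hP).1.

Lemma near_proj (U : set M) p : open U -> U (tau p) -> \forall q \near p, U (tau q).
Proof. by have [ct _] := proj_smooth hP p; exact: continuous_near_open. Qed.

Lemma local_contact_ratio x : exists (U : set M) (eta : tensor_field M 1) (lam : P -> R),
  [/\ open U, U x & contact_form_on U eta] /\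
  [/\ forall p, U (tau p) -> forall w, phi p w = lam p * eta (tau p) (fun=> w),
      forall p, U (tau p) -> lam p != 0
    & forall p, U (tau p) -> smooth_real lam p].
Proof.
have [_ _ /(_ x) [U [eta [oU Ux ceta keta]]]] := hM.
(* Chosen point by point, with no regularity in [p]; smoothness of the resulting [lam] comes from
   [smooth_ratio]. *)
pose wp p := projT1 (cid (Phi_neq0 hM hP p)).
have wp0 p : phi p (wp p) != 0 by rewrite /wp; case: cid.
have [[seta _] _] := ceta.
have leta y : U y -> linear_fun (fun w => eta y (fun=> w)).
  by move=> Uy; apply/multilinear1P; have [] := seta y Uy.
have ker p w : U (tau p) -> eta (tau p) (fun=> w) = 0 <-> phi p w = 0.
  move=> Up; apply: iff_trans _ (Phi_ker hM hP p w).
  by have := congr1 (@^~ w) (keta _ Up); rewrite /kernel1 /= => ->.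
have ewp p : U (tau p) -> eta (tau p) (fun=> wp p) != 0.
  by move=> Up; apply: contra (wp0 p) => /eqP/(ker _ _ Up) ->.
pose lam p := phi p (wp p) / eta (tau p) (fun=> wp p).
have Elam p : U (tau p) -> forall w, phi p w = lam p * eta (tau p) (fun=> w).
  move=> Up; apply: linear_fun_proportional (leta _ Up) _ (ewp p Up) _.
    exact: Phi_linear.
  by move=> u /(ker p u Up).
exists U, eta, lam; split; split=> //.
  by move=> p Up; rewrite mulf_neq0 // invr_eq0 ewp.
move=> p Up; have [u0 Eu0] := tangent_proj_surj hM hP p (wp p).
have nU := near_proj oU Up.
apply: (@smooth_ratio _ _ _ P M (total_charts hP) (base_charts hM) tau
  (liouville h omega) eta _ lam p u0).
- by move=> q _; exact: (proj_smooth hP).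
- by have [] := liouville_form hP (x := p) I.
- by have [] := seta _ Up.
- apply: filterS (open_nbhs_nbhs (conj oU Up)) => y Uy.
  by have [] := seta y Uy.
- by apply: filterS nU => q Uq u; rewrite -(PhiE hM hP) Elam.
- by rewrite Eu0 ewp.
Qed.

Definition dual_vector p := riesz (gM (tau p)) (phi p).

(** The dual norm of the covector. Its definition requires no choice of a normal vector, and
    [metric_calibE] recovers the quotient for every such vector. *)
Definition metric_calib (p : P) : R := Num.sqrt (phi p (dual_vector p)).

Let mg y : multilinear (gM y).
Proof. by have [sg _ _] := hg; have [] := sg y I. Qed.

Let pg y v : v != 0 -> 0 < gM y (pair_of v v).
Proof. by have [_ _ ] := hg; apply. Qed.

Lemma dual_vectorE p u : gM (tau p) (pair_of (dual_vector p) u) = phi p u.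
Proof.
apply: rieszE; [exact: mg | apply: gram_unit; [exact: mg | exact: pg] |].
exact: Phi_linear.
Qed.

Lemma dual_vector_neq0 p : dual_vector p != 0.
Proof.
have [w] := Phi_neq0 hM hP p; apply: contraNneq => d0.
by rewrite -dual_vectorE d0 (linear_fun0 (((multilinear2P _).1 (mg (tau p))).1 w)).
Qed.

Lemma dual_gt0 p : 0 < phi p (dual_vector p).
Proof. by rewrite -dual_vectorE; apply/pg/dual_vector_neq0. Qed.

Lemma metric_calib_gt0 p : 0 < metric_calib p.
Proof. by rewrite sqrtr_gt0 dual_gt0. Qed.

Lemma metric_calib_action t p : t != 0 ->
  metric_calib (h t p) = `|t| * metric_calib p.
Proof.
move=> t0.
have E u : phi (h t p) u = t * phi p u by exact: Phi_action.
have E1 : dual_vector (h t p) = t *: dual_vector p.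
  rewrite {1}/dual_vector (proj_action hP p t0); exact: riesz_scale.
have E2 : phi p (t *: dual_vector p) = t * phi p (dual_vector p).
  exact: (linear_funZ _ _ (Phi_linear hM hP p)).
have E3 : phi (h t p) (dual_vector (h t p)) = t ^+ 2 * phi p (dual_vector p).
  apply: (etrans (congr1 _ E1)); apply: (etrans (E _)).
  by apply: (etrans (congr1 _ E2)); rewrite mulrA.
apply: (etrans (congr1 Num.sqrt E3)).
by rewrite (sqrtrM _ (sqr_ge0 t)) sqrtr_sqr.
Qed.

Lemma metric_calibE p v : v != 0 ->
  (forall u, u \in C (tau p) -> gM (tau p) (pair_of v u) = 0) ->
  metric_calib p = `|phi p v| / Num.sqrt (gM (tau p) (pair_of v v)).
Proof.
move=> v0 ov; have [_ sg _] := hg.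
apply: (dual_norm (mg (tau p)) (sg (tau p)) (@pg (tau p)) (Phi_linear hM hP p)) => //.
  exact: dual_vectorE.
by move=> u /Phi_ker; exact: ov.
Qed.

Lemma metric_calib_metric : metric_calibration tau h C omega gM metric_calib.
Proof.
move=> p.
have lin : linear_for *%R (phi p) by move=> c u w; exact: Phi_linear.
pose xi : {scalar 'rV[R]_(n.*2.+1)} :=
  HB.pack (phi p) (GRing.isLinear.Build _ _ _ _ (phi p) lin).
exists xi; first by move=> v; rewrite /= PhiE.
by move=> v v0 ov; exact: metric_calibE.
Qed.

(** The dual vector is itself nonzero and normal to [C], so it is an admissible test vector and pins
    down the value at each point. *)
Lemma metric_calib_unique s :
  metric_calibration tau h C omega gM s -> metric_calib = s.
Proof.
move=> Hs; apply/funext => p; have [xi Hxi Hv] := Hs p.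
have ov u : u \in C (tau p) -> gM (tau p) (pair_of (dual_vector p) u) = 0.
  by move=> /(Phi_ker hM hP p u); rewrite dual_vectorE.
rewrite (metric_calibE (dual_vector_neq0 p) ov) (Hv _ (dual_vector_neq0 p) ov).
have [u <-] := tangent_proj_surj hM hP p (dual_vector p).
by rewrite PhiE Hxi.
Qed.

Lemma metric_calib_smooth p : smooth_real metric_calib p.
Proof.
have [U [eta [lam [[oU Up [[seta _] _]] [Elam l0 sl]]]]] := local_contact_ratio (tau p).
(* The squared dual norm is quadratic, hence the two factors [lam]. Its positivity keeps the square
   root smooth. *)
pose Q q := lam q * (lam q * dual_sq gM eta (tau q)).
have EQ q : U (tau q) -> phi q (dual_vector q) = Q q.
  move=> Uq; have Eq := Elam _ Uq.
  pose r := riesz (gM (tau q)) (fun u => eta (tau q) (fun=> u)).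
  have E1 : dual_vector q = lam q *: r := riesz_scale _ Eq.
  have E2 : phi q (lam q *: r) = lam q * phi q r.
    exact: (linear_funZ _ _ (Phi_linear hM hP q)).
  apply: (etrans (congr1 _ E1)); apply: (etrans E2).
  by rewrite (Eq r).
have sQ : smooth_real Q p.
  apply: (smooth_realM gdP); first exact: sl.
  apply: (smooth_realM gdP); first exact: sl.
  apply: (@smooth_at_comp _ _ _ _ P M (real_line R) gdP gdM tau (dual_sq gM eta)).
    exact: (proj_smooth hP).
  apply: (smooth_dual_sq (base_charts hM) hg); first by have [] := seta _ Up.
  apply: filterS (open_nbhs_nbhs (conj oU Up)) => y Uy.
  by have [] := seta y Uy.
have ss : smooth_real (fun q => Num.sqrt (Q q)) p.
  by apply: (smooth_real_sqrt gdP) => //; rewrite -EQ // dual_gt0.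
apply: (near_smooth_at (N' := real_line R) gdP _ ss).
by apply: filterS (near_proj oU Up) => q Uq; rewrite /metric_calib EQ.
Qed.

Lemma metric_calib_calibration : calibration h metric_calib.
Proof.
split; first by move=> p _; exact: metric_calib_smooth.
  exact: metric_calib_gt0.
by move=> t p t0; exact: metric_calib_action.
Qed.

End Calibration.

(** * Manifold structure on a level set made of sheets *)

Section Subspace.
Variables (T : topologicalType) (S : set T).

Lemma continuous_set_val (q : set_type S) : {for q, continuous (@set_val T S)}.
Proof. exact: initial_continuous. Qed.

Lemma continuous_into_set_type (X : topologicalType) (f : X -> set_type S) x :
  {for x, continuous (set_val \o f)} -> {for x, continuous f}.
Proof.
move=> cf A [B [ [Q oQ <-] Bfx BA]].
have := continuous_near_open cf oQ Bfx.
by apply: (@filterS _ _ (nbhs_filter x)) => z Qz; exact: BA.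
Qed.

Lemma set_type_hausdorff : hausdorff_space T -> hausdorff_space (set_type S).
Proof.
move=> hT p q pq; apply: val_inj; rewrite -set_valE; apply: hT => A B nA nB.
have [z [Az Bz]] : (set_val @^-1` A `&` set_val @^-1` B : set (set_type S)) !=set0.
  apply: pq; first by have := @continuous_set_val p _ nA.
  by have := @continuous_set_val q _ nB.
by exists (set_val z).
Qed.

Lemma set_type_second_countable : @second_countable T -> @second_countable (set_type S).
Proof.
move=> [B cB [oB bB]]; exists [set (@set_val T S) @^-1` b | b in B].
  exact: card_le_trans (card_image_le _ _) cB.
split=> [_ [b Bb <-]|x A [B' [ [Q oQ <-] Qx QA]]]; first by exists b => //; exact: oB.
have [b [Bb bx] bQ] := bB (set_val x) Q (open_nbhs_nbhs (conj oQ Qx)).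
by exists ((@set_val T S) @^-1` b); [split=> //; exists b | move=> z /bQ; exact: QA].
Qed.

End Subspace.

(* [sg] parametrizes an open piece of the subspace [S] over [U]. *)
Definition is_sheet (R : realType) (d e : nat) (M : charted R d) (P : charted R e)
    (tau : P -> M) (S : set P) (q : set_type S) (U : set M) (sg : M -> P) : Prop :=
  [/\ open U, U (tau (set_val q)), smooth_on U sg,
      forall x, U x -> tau (sg x) = x /\ S (sg x)
    & sg (tau (set_val q)) = set_val q /\
      open [set q' : set_type S |
        U (tau (set_val q')) /\ set_val q' = sg (tau (set_val q'))]].

Section Sheets.
Variables (R : realType) (d e : nat) (M : charted R d) (P : charted R e).
Variables (tau : P -> M) (S : set P).
Hypotheses (sM : smooth_charts M) (sP : smooth_manifold P).
Hypothesis st : forall p, smooth_at tau p.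
Hypothesis sheets : forall q : set_type S,
  exists Us : set M * (M -> P), is_sheet tau q Us.1 Us.2.

Let gdM : good_charts M := sM.1.
Let gdP : good_charts P := (smooth_manifold_charts sP).1.

Definition sheet_dom q : set M := (projT1 (cid (sheets q))).1.
Definition sheet_sec q : M -> P := (projT1 (cid (sheets q))).2.

Lemma sheetP q : is_sheet tau q (sheet_dom q) (sheet_sec q).
Proof. by rewrite /sheet_dom /sheet_sec; case: cid. Qed.

(** Reusing the base chart indexed by [tau q] gives [q] the coordinates of its projection. The
    default [q] of [insubd] only matters outside [sheet_dom q], over which the section stays in
    [S]. *)
Definition sheet_chart (q : set_type S) : chart R (set_type S) d :=
  let c := chart_at (tau (set_val q)) in
  Chart [set q' | cdom c (tau (set_val q')) /\ (sheet_dom q (tau (set_val q')) /\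
                  set_val q' = sheet_sec q (tau (set_val q')))]
        (fun q' => cmap c (tau (set_val q')))
        (fun y => insubd q (sheet_sec q (cinv c y))).

Definition sheet_space : charted R d := Charted sheet_chart.
Local Notation N := sheet_space.
Definition sheet_incl : N -> P := @set_val P S.
Definition sheet_proj : N -> M := tau \o sheet_incl.
Local Notation incl := sheet_incl.
Local Notation tau' := sheet_proj.

Lemma insubd_val (q : set_type S) p : S p -> set_val (insubd q p) = p.
Proof. by move=> Sp; rewrite set_valE insubdK //; exact: mem_set. Qed.

Lemma continuous_sheet_proj (q : N) : {for q, continuous tau'}.
Proof.
have [ct _] := st (incl q).
exact: (continuous_comp (continuous_set_val (q := q)) ct).
Qed.

Lemma sheet_cinv (q : N) y : sheet_dom q (cinv (chart_at (tau' q)) y) ->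
  incl (cinv (chart_at q) y) = sheet_sec q (cinv (chart_at (tau' q)) y) /\
  tau' (cinv (chart_at q) y) = cinv (chart_at (tau' q)) y.
Proof.
move=> Uy; have [_ _ _ /(_ _ Uy) [tK Ss] _] := sheetP q.
have E : incl (cinv (chart_at q) y) = sheet_sec q (cinv (chart_at (tau' q)) y).
  exact: (insubd_val q Ss).
by rewrite /sheet_proj /= E.
Qed.

Lemma near_sheet_dom (q : N) z : cdom (chart_at q) z ->
  \forall y \near cmap (chart_at q) z, sheet_dom q (cinv (chart_at (tau' q)) y).
Proof.
move=> [Dz [Uz _]]; have [oU _ _ _ _] := sheetP q; have [cx _] := gdM (tau' q).
exact: (near_cinv cx Dz (open_nbhs_nbhs (conj oU Uz))).
Qed.

Lemma sheet_good : good_charts N.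
Proof.
move=> q; have [oU Uq sU tU [Eq oV]] := sheetP q; have [cx Dx] := gdM (tau' q).
split; last by split => //; split => //; rewrite Eq.
(* Described on the base, the image of the chart is visibly open, and every point of it lifts
   through the section. *)
have im : cmap (chart_at q) @` cdom (chart_at q) =
    [set y | (cmap (chart_at (tau' q)) @` cdom (chart_at (tau' q))) y /\
             sheet_dom q (cinv (chart_at (tau' q)) y)].
  apply/seteqP; split=> [_ [z [Dz [Uz Ez]] <-]|y [Iy Uy]].
    split; first by exists (tau' z).
    by rewrite /= (cinvK cx).
  have [Ei Et] := sheet_cinv Uy.
  have Dy := cdom_cinv cx Iy.
  exists (cinv (chart_at q) y); last first.
    by rewrite -[RHS](cmapK cx Iy) -Et.
  set z := cinv (chart_at q) y in Ei Et *.
  suff : cdom (chart_at (tau' q)) (tau' z) /\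
      (sheet_dom q (tau' z) /\ incl z = sheet_sec q (tau' z)) by [].
  by rewrite Et.
split.
- apply: open_of_nbhs => z [Dz UEz].
  apply: (@filterI _ _ (nbhs_filter z) (tau' @^-1` cdom (chart_at (tau' q)))).
    have [oD _ _ _ _] := cx.
    exact: continuous_near_open (continuous_sheet_proj (q := z)) oD Dz.
  exact: open_nbhs_nbhs.
- rewrite im; apply: open_of_nbhs => y [Iy Uy].
  apply: (@filterI _ _ (nbhs_filter y)).
    by have [_ oI _ _ _] := cx; exact: open_nbhs_nbhs.
  have Dy := cdom_cinv cx Iy.
  by have := near_cinv cx Dy (open_nbhs_nbhs (conj oU Uy)); rewrite (cmapK cx Iy).
- move=> z [Dz _].
  have [_ _ /(_ _ Dz) cc _ _] := cx.
  exact: (continuous_comp (continuous_sheet_proj (q := z)) cc).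
- move=> y; rewrite im => -[Iy Uy]; apply: continuous_into_set_type.
  have Dy := cdom_cinv cx Iy.
  have nU := near_cinv cx Dy (open_nbhs_nbhs (conj oU Uy)).
  rewrite (cmapK cx Iy) in nU.
  have nE : {near y, sheet_sec q \o cinv (chart_at (tau' q)) =1
      set_val \o cinv (chart_at q)}.
    by apply: filterS nU => y' Uy'; have [] := sheet_cinv Uy'.
  have [cs _] := sU _ Uy.
  have [_ _ _ /(_ _ Iy) ci _] := cx.
  rewrite /prop_for /continuous_at -(nbhs_singleton nE).
  exact: cvg_trans (near_eq_cvg nE) (continuous_comp ci cs).
- move=> z [Dz [Uz Ez]]; apply: val_inj; rewrite -set_valE /= (cinvK cx) //.
  by rewrite -Ez insubd_val // Ez; have [] := tU _ Uz.
Qed.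

Lemma sheet_manifold : smooth_manifold N.
Proof.
have [hP cP _ _] := sP; split.
- exact: set_type_hausdorff.
- exact: set_type_second_countable.
- exact: sheet_good.
- move=> q q' z Dz Dz'; have [Dz1 _] := Dz; have [Dz1' _] := Dz'.
  have Cc := sM.2 _ _ _ Dz1 Dz1'.
  apply: near_eq_Cinf_at Cc; apply: filterS (near_sheet_dom Dz) => y Uy.
  by have [_ Et] := sheet_cinv Uy; rewrite /= -[in LHS]Et.
Qed.

Lemma smooth_at_sheet_proj (q : N) : smooth_at tau' q.
Proof.
split; first exact: continuous_sheet_proj.
have [_ Dq] := sheet_good q; have [cx Dx] := gdM (tau' q).
apply: near_eq_Cinf_at (Cinf_at_id _).
apply: filterS2 (near_sheet_dom Dq) (near_cim cx Dx) => y Uy Iy.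
by have [_ Et] := sheet_cinv Uy; rewrite /local_expr [in RHS]/comp Et (cmapK cx Iy).
Qed.

Lemma tangent_sheet_proj (q : N) v : tangent_map tau' q v = v.
Proof.
have [_ Dq] := sheet_good q; have [cx Dx] := gdM (tau' q).
apply: near_id_diff; apply: filterS2 (near_sheet_dom Dq) (near_cim cx Dx) => y Uy Iy.
by have [_ Et] := sheet_cinv Uy; rewrite /local_expr [in RHS]/comp Et (cmapK cx Iy).
Qed.

Lemma smooth_at_sheet_incl (q : N) : smooth_at incl q.
Proof.
split; first exact: (continuous_set_val (q := q)).
have [_ Dq] := sheet_good q; have [_ Uq sU _ [Eq _]] := sheetP q.
have [_ ss] := sU _ Uq.
apply: near_eq_Cinf_at ss; apply: filterS (near_sheet_dom Dq) => y Uy.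
have [Ei _] := sheet_cinv Uy.
by rewrite /local_expr [in RHS]/comp Ei Eq.
Qed.

(** The inclusion is an immersion because its composition with the projection has the identity as
    tangent map. *)
Lemma sheet_embedded : embedded_submanifold sheet_chart.
Proof.
split; first exact: sheet_manifold.
  by move=> q _; exact: smooth_at_sheet_incl.
move=> q v w E; rewrite -(tangent_sheet_proj q v) -(tangent_sheet_proj q w).
have si := smooth_at_sheet_incl q.
rewrite (tangent_map_comp sheet_good gdP v si (st _)).
rewrite (tangent_map_comp sheet_good gdP w si (st _)).
by congr tangent_map.
Qed.

(* In the charts of [N], the local expression of a map into [N] is that of its
   composition with the projection. *)
Lemma smooth_at_to_sheet (k : nat) (X : charted R k) (f : X -> N) x :
  {for x, continuous (incl \o f)} -> smooth_at (tau' \o f) x -> smooth_at f x.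
Proof. by move=> cf [_ sf]; split=> //; exact: continuous_into_set_type. Qed.

Lemma tangent_map_to_sheet (k : nat) (X : charted R k) (f : X -> N) x v :
  tangent_map f x v = tangent_map (tau' \o f) x v.
Proof. by []. Qed.

(** Near [q] the same components describe a tangent vector upstairs and its projection, so local
    expressions of forms on both spaces can be compared directly. *)
Lemma near_sheet_transition (q : N) : \forall y \near coord q,
  tau' (cinv (chart_at q) y) = cinv (chart_at (tau' q)) y /\
  forall v, transition q y v = transition (tau' q) y v.
Proof.
have [cq Dq] := sheet_good q; have [oU _ _ _ _] := sheetP q.
have [cx Dx] := gdM (tau' q).
apply: filterS2 (near_sheet_dom Dq) (near_cim cx Dx) => y Uy Iy.
have [_ Et] := sheet_cinv Uy; split; first exact: Et.
move=> v.
rewrite /transition.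
pose A := cmap (chart_at (tau' (cinv (chart_at q) y))) \o cinv (chart_at (tau' q)).
have H : {near y, A =1 cmap (chart_at (cinv (chart_at q) y)) \o cinv (chart_at q)}.
  have Dy := cdom_cinv cx Iy.
  have := near_cinv cx Dy (open_nbhs_nbhs (conj oU Uy)); rewrite (cmapK cx Iy).
  by apply: filterS => y' Uy'; have [_ Et'] := sheet_cinv Uy'; rewrite /A /= -[in LHS]Et'.
have dA : differentiable A y.
  rewrite -[X in differentiable _ X](cmapK cx Iy) /A Et.
  apply: Cinf_at_diff; apply: sM.2; first exact: cdom_cinv.
  exact: (gdM _).2.
apply: (etrans (congr1 (@^~ v) (near_eq_diff H dA))).
by rewrite /A Et.
Qed.

End Sheets.

(** * The double cover *)

Section DoubleCover.
Variables (R : realType) (n : nat).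
Variables (M : charted R n.*2.+1) (C : M -> {vspace 'rV[R]_(n.*2.+1)}).
Variables (P : charted R n.*2.+2) (tau : P -> M) (h : R -> P -> P).
Variables (omega : tensor_field P 2) (gM : tensor_field M 2).
Hypotheses (hM : contact_manifold C) (hP : symplectic_cover tau h C omega).
Hypothesis hg : riemannian gM.

Local Notation phi := (Phi hM hP).
Local Notation cal := (metric_calib gM hM hP).
Let gdM : good_charts M := (base_charts hM).1.
Let gdP : good_charts P := (total_charts hP).1.
Let gdR : good_charts (real_line R) := @real_line_good R.
Let theta := liouville h omega.

Lemma normal_section x : exists (U : set M) (sg : M -> P) (rho : P -> R),
  [/\ open U, U x, smooth_on U sg & forall x', U x' -> tau (sg x') = x' /\ cal (sg x') = 1] /\
  [/\ forall p, U (tau p) -> {for p, continuous rho},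
      forall p, U (tau p) -> rho p != 0,
      forall p, U (tau p) -> h (rho p) (sg (tau p)) = p
    & forall s p, s != 0 -> U (tau p) -> rho (h s p) = s * rho p].
Proof.
have [U [sg [rho [[oU Ux ss ts] [sr r0 Kr Er]]]]] := local_section hM hP x.
have c0 p : cal p != 0 by rewrite gt_eqF // metric_calib_gt0.
have cV0 p : (cal p)^-1 != 0 by rewrite invr_eq0.
have scs x' : U x' -> smooth_real (cal \o sg) x'.
  move=> Ux'; apply: (@smooth_at_comp _ _ _ _ M P (real_line R) gdM gdP sg cal).
    exact: ss.
  exact: metric_calib_smooth.
(* Dividing the section by its calibration is compensated by multiplying the fibre coordinate, so
   that [p] is still recovered from both. *)
exists U, (fun x' => h (cal (sg x'))^-1 (sg x')), (fun p => rho p * cal (sg (tau p))).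
split; split; [exact: oU | exact: Ux | | | | | | ].
- move=> x' Ux'; pose RP := prod_charted (real_line R) P.
  apply: (@smooth_at_comp _ _ _ _ M RP P gdM (prod_good gdR gdP)
    (fun y => ((cal (sg y))^-1, sg y)) (fun z => h z.1 z.2)).
    apply: smooth_at_pair; last exact: ss.
    apply: (smooth_realV gdM (f := cal \o sg)); [exact: c0 | exact: scs].
  by apply: (action_smooth hP); split=> //; exact: cV0.
- move=> x' Ux'; rewrite (proj_action hP _ (cV0 _)); split; first exact: ts.
  rewrite (metric_calib_action gM hM hP _ (cV0 _)) normfV.
  by rewrite (gtr0_norm (metric_calib_gt0 hM hP hg _)) mulVf.
- move=> p Up; have [c1 _] := sr p Up.
  have st : smooth_real (fun p => rho p * cal (sg (tau p))) p.
    apply: (smooth_realM gdP (f := rho) (g := (cal \o sg) \o tau)); first exact: sr.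
    apply: (@smooth_at_comp _ _ _ _ P M (real_line R) gdP gdM tau (cal \o sg)).
      exact: (proj_smooth hP).
    exact: scs.
  by have [] := st.
- by move=> p Up; rewrite mulf_neq0 ?r0.
- move=> p Up; rewrite (action_comp hP) //; last by rewrite mulf_neq0 ?r0.
  by rewrite mulfK // Kr.
- by move=> s p s0 Up; rewrite Er // (proj_action hP) // mulrA.
Qed.

Definition unit_level : set P := [set p | cal p - 1 = 0].
Local Notation S := unit_level.

Lemma unit_levelP p : S p <-> cal p = 1.
Proof. by rewrite /unit_level /=; split=> [/eqP|->]; rewrite ?subrr // subr_eq0 => /eqP. Qed.

(** The negated exponent makes [true] the sheet of [sg] itself and [false] the opposite one. *)
Definition branch (sg : M -> P) (b : bool) (x : M) : P := h ((-1) ^+ (~~ b)) (sg x).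

(* The two sheets over a trivializing open set are told apart by the sign of
   the fibre coordinate, which is [1] or [-1] on the unit level. *)
Lemma unit_sheets x : exists (U : set M) (sg : M -> P),
  [/\ open U, U x,
     forall b, smooth_on U (branch sg b),
     forall b y, U y -> tau (branch sg b y) = y /\ S (branch sg b y)
   & [/\ forall y, U y -> branch sg true y != branch sg false y,
     forall p, S p -> U (tau p) -> exists b, p = branch sg b (tau p)
   & forall b, open [set q : set_type S |
        U (tau (set_val q)) /\ set_val q = branch sg b (tau (set_val q))]]].
Proof.
have [U [sg [rho [[oU Ux ss ts] [cr r0 Kr Er]]]]] := normal_section x.
have e0 (b : bool) : (-1) ^+ b != 0 :> R by rewrite signr_eq0.
exists U, sg.
have rsg y : U y -> rho (sg y) = 1.
  move=> Uy; have [ty _] := ts _ Uy.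
  have Uty : U (tau (sg y)) by rewrite ty.
  have := congr1 rho (Kr _ Uty); rewrite ty Er ?r0 // => E.
  by apply: (mulfI (r0 _ Uty)); rewrite mulr1.
have rbr b y : U y -> rho (branch sg b y) = (-1) ^+ (~~ b).
  move=> Uy; have [ty _] := ts _ Uy.
  by rewrite /branch Er ?rsg ?mulr1 // ty.
have tbr b y : U y -> tau (branch sg b y) = y.
  by move=> Uy; rewrite /branch (proj_action hP) //; have [] := ts _ Uy.
(* Both sides of [h (rho p) (sg (tau p)) = p] are calibrated, the section having calibration [1]. *)
have nrho p : S p -> U (tau p) -> `|rho p| = 1.
  move=> /unit_levelP cp Up; rewrite -[RHS]cp -[in RHS](Kr p Up).
  rewrite (metric_calib_action gM hM hP _ (r0 _ Up)).
  by have [_ ->] := ts _ Up; rewrite mulr1.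
(* Lying on a sheet becomes a strict inequality instead of an equation; this makes the sheets open
   in the level set. *)
have sgn b p : S p -> U (tau p) ->
    p = branch sg b (tau p) <-> 0 < (-1) ^+ (~~ b) * rho p.
  move=> Sp Up; split=> [E|pos].
    by rewrite E rbr // -expr2 sqrr_sign ltr01.
  have E : (-1) ^+ (~~ b) * rho p = 1.
    by rewrite -(gtr0_norm pos) normrM normr_sign mul1r nrho.
  have -> : branch sg b (tau p) = h (rho p) (sg (tau p)).
    have Es : rho p = (-1) ^+ (~~ b).
      by apply: (mulfI (e0 (~~ b))); rewrite E -expr2 sqrr_sign.
    by rewrite /branch -Es.
  by rewrite Kr.
split; [exact: oU | exact: Ux | | | split].
- move=> b y Uy.
  apply: (@smooth_at_comp _ _ _ _ M P P gdM gdP sg (h ((-1) ^+ (~~ b)))).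
    exact: ss.
  exact: (smooth_action hP).
- move=> b y Uy; split; first exact: tbr.
  apply/unit_levelP; rewrite /branch (metric_calib_action gM hM hP _ (e0 _)).
  by rewrite normr_sign mul1r; have [] := ts _ Uy.
- move=> y Uy; apply/eqP => /(congr1 rho); rewrite !rbr // expr0 expr1 => /eqP.
  by rewrite -subr_eq0 opprK -mulr2n pnatr_eq0.
- move=> p Sp Up; exists (0 < rho p); apply/sgn => //.
  have [pos|] := ltP 0 (rho p); first by rewrite mul1r.
  by rewrite le_eqVlt (negPf (r0 _ Up)) /= mulN1r oppr_gt0.
- move=> b; apply: open_of_nbhs => q [Uq Eq].
  have Sq p : S (set_val (p : set_type S)) by exact: set_valP.
  have nU : \forall q' \near q, U (tau (set_val q')).
    have [ct _] := proj_smooth hP (set_val q).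
    have cc := continuous_comp (continuous_set_val (q := q)) ct.
    exact: (continuous_near_open cc oU Uq).
  have cc := continuous_comp (continuous_set_val (q := q)) (cr _ Uq).
  have pos : 0 < (-1) ^+ (~~ b) * rho (set_val q) by apply/sgn.
  have nP : \forall q' \near q, 0 < (-1) ^+ (~~ b) * rho (set_val q').
    have cm : {for q, continuous (fun q' : set_type S => (-1) ^+ (~~ b) * rho (set_val q'))}.
      apply: (continuous_comp cc); exact: mulrl_continuous.
    exact: (continuous_near_open cm (@open_gt R 0) pos).
  apply: filterS2 nU nP => q' Uq' Pq'; split=> //.
  by apply/sgn.
Qed.

Lemma unit_sheet (q : set_type S) : exists Us : set M * (M -> P), is_sheet tau q Us.1 Us.2.
Proof.
have [U [sg [oU Ux sb tb [_ ex op]]]] := unit_sheets (tau (set_val q)).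
have [b Eb] := ex _ (set_valP q) Ux.
exists (U, branch sg b); split=> /=; [exact: oU | exact: Ux | exact: sb | exact: tb |].
by split; [rewrite set_valE -Eb | exact: op].
Qed.

Definition unit_chart := sheet_chart unit_sheet.
Let Mt : charted R n.*2.+1 := Charted unit_chart.
Let incl : Mt -> P := set_val.
Let tau' : Mt -> M := tau \o incl.
Let eta : tensor_field Mt 1 := pullback incl theta.
Let sP : smooth_manifold P.
Proof. by have [[[[]]]] := hP. Qed.
Let sM := base_charts hM.
Let st := proj_smooth hP.

Lemma unit_embedded : embedded_submanifold unit_chart.
Proof. exact: (sheet_embedded sM sP st). Qed.

Lemma unit_proj_smooth (q : Mt) : smooth_at tau' q.
Proof. exact: (smooth_at_sheet_proj sM st). Qed.

Lemma unit_incl_smooth (q : Mt) : smooth_at incl q.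
Proof. exact: (smooth_at_sheet_incl sM st). Qed.

Lemma unit_tangent_proj (q : Mt) v : tangent_map tau' q v = v.
Proof. exact: (tangent_sheet_proj sM st). Qed.

Let incl_inj : injective incl.
Proof. by move=> q q'; rewrite /incl set_valE => /val_inj. Qed.

Lemma unit_two_sheeted_cover : two_sheeted_cover tau'.
Proof.
split; first by move=> q _; exact: unit_proj_smooth.
move=> x; have [U [sg [oU Ux sb tb [db ex op]]]] := unit_sheets x.
exists U, (fun b => [set q : Mt | U (tau' q) /\ incl q = branch sg b (tau' q)]).
split=> //; split=> //.
- apply/seteqP; split=> // q [[Uq E1] [_ E2]].
  by have := db _ Uq; rewrite -E1 E2 eqxx.
- apply/seteqP; split=> [q Uq|q [] []//].
  have [[] Eb] := ex _ (set_valP q) Uq; [by left | by right].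
- move=> b; have [_ Sx] := tb b _ Ux.
  (* Only a default for [insubd]: over [U] the branch takes its values in the level set. *)
  pose q0 : Mt := SigSub (mem_set Sx).
  pose g x' : Mt := insubd q0 (branch sg b x').
  have Eg y : U y -> incl (g y) = branch sg b y.
    by move=> Uy; apply: insubd_val; have [] := tb b _ Uy.
  have tg y : U y -> tau' (g y) = y.
    by move=> Uy; rewrite /tau' /= Eg //; have [] := tb b _ Uy.
  exists g; split.
  + by move=> q _; exact: unit_proj_smooth.
  + move=> y Uy; have nU := open_nbhs_nbhs (conj oU Uy).
    apply: (smooth_at_to_sheet (sheets := unit_sheet)).
      have nE : {near y, branch sg b =1 incl \o g}.
        by apply: filterS nU => z Uz; exact: (esym (Eg z Uz)).
      have [cb _] := sb b _ Uy.
      rewrite /prop_for /continuous_at -(nbhs_singleton nE).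
      exact: cvg_trans (near_eq_cvg nE) cb.
    apply: (near_smooth_at (f := id) gdM); last exact: smooth_at_id.
    by apply: filterS nU => z Uz; exact: (esym (tg z Uz)).
  + move=> q [Uq Eq]; split; first exact: Uq.
    apply: incl_inj; exact: (etrans (Eg _ Uq) (esym Eq)).
  + move=> y Uy; split; last exact: tg.
    by rewrite /= (tg y Uy); split; [exact: Uy | exact: Eg].
Qed.

Let n1 : (-1 : R) != 0.
Proof. by rewrite oppr_eq0 oner_neq0. Qed.

Lemma unit_level_opp p : S p -> S (h (-1) p).
Proof.
move=> /unit_levelP Sp; apply/unit_levelP.
by rewrite (metric_calib_action gM hM hP _ n1) Sp normrN normr1 mulr1.
Qed.

Definition flip (q : Mt) : Mt := insubd q (h (-1) (incl q)).

Lemma flipE q : incl (flip q) = h (-1) (incl q).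
Proof. exact/insubd_val/unit_level_opp/set_valP. Qed.

Lemma flip_proj q : tau' (flip q) = tau' q.
Proof. by rewrite /tau' /= flipE (proj_action hP). Qed.

Lemma flipK q : flip (flip q) = q.
Proof.
by apply: incl_inj; rewrite !flipE (action_comp hP) // mulrNN mulr1 (action1 hP).
Qed.

Lemma flip_smooth q : smooth_at flip q.
Proof.
apply: (smooth_at_to_sheet (sheets := unit_sheet)).
  have -> : @sheet_incl _ _ _ _ _ _ _ unit_sheet \o flip = h (-1) \o incl.
    by apply/funext => z; exact: flipE.
  have [ch _] := smooth_action hP (incl q) n1.
  exact: (continuous_comp (continuous_set_val (q := q)) ch).
have -> : sheet_proj (sheets := unit_sheet) \o flip = tau'.
  by apply/funext => z; exact: flip_proj.
exact: unit_proj_smooth.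
Qed.

Lemma flip_tangent q v : tangent_map flip q v = v.
Proof.
rewrite (@tangent_map_to_sheet _ _ _ _ _ _ _ unit_sheet).
have -> : sheet_proj (sheets := unit_sheet) \o flip = tau'.
  by apply/funext => z; exact: flip_proj.
exact: unit_tangent_proj.
Qed.

Lemma action_opp_neq p : h (-1) p != p.
Proof.
have [U [sg [rho [[_ Ux _ _] [_ r0 _ Er]]]]] := normal_section (tau p).
apply/eqP => /(congr1 rho); rewrite Er // => /eqP.
by rewrite mulN1r -subr_eq0 -opprD oppr_eq0 -mulr2n mulrn_eq0 /= (negPf (r0 _ Ux)).
Qed.

(** The projection is injective on each sheet and invariant under [flip]. If [flip] kept a point in
    its sheet it would fix it, contradicting [action_opp_neq]. *)
Lemma flip_sheets U V b : two_sheets tau' U V -> flip @` V b = V (~~ b).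
Proof.
move=> [_ _ _ UV dV].
have swap c q : V c q -> V (~~ c) (flip q).
  move=> Vq; have [g [_ _ K _]] := dV c; have [Uq Kq] := K _ Vq.
  have : (tau' @^-1` U) (flip q) by rewrite /= flip_proj.
  rewrite UV => Vf; case: (boolP (`[< V c (flip q) >])) => [/asboolP Vcf|/asboolPn nV].
    have [_ Kf] := K _ Vcf; case/eqP: (action_opp_neq (incl q)).
    by rewrite -flipE -Kf flip_proj Kq.
  by case: c {Vq g K Kq dV} nV => nV; case: Vf.
apply/seteqP; split=> [_ [q Vq <-]|q Vq]; first exact: swap.
by exists (flip q); [rewrite -[b]negbK; exact: swap | exact: flipK].
Qed.

(** As the tangent map of the projection is the identity in these charts, the restricted form is the
    covector of the point, with no lift left to choose. *)
Lemma unit_formE q v : eta q v = phi (incl q) (v ord0).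
Proof.
rewrite -[in RHS](unit_tangent_proj q (v ord0)).
have gdN := sheet_good sM st (sheets := unit_sheet).
rewrite (tangent_map_comp gdN gdP _ (unit_incl_smooth q) (st _)).
rewrite PhiE /eta /pullback; congr (theta _ _).
by apply/funext => i; rewrite (ord1 i).
Qed.

Lemma unit_form_flip q v : pullback flip eta q v = - eta q v.
Proof.
rewrite /pullback !unit_formE flip_tangent flipE.
by rewrite (Phi_action hM hP _ _ n1) mulN1r.
Qed.

Lemma unit_form_kernel q v : kernel1 eta q v <-> tangent_map tau' q v \in C (tau' q).
Proof.
rewrite unit_tangent_proj; apply: iff_trans (iff_sym (Phi_ker hM hP (incl q) v)).
by rewrite /kernel1 /= unit_formE.
Qed.

Lemma unit_form_image x : tangent_image tau' (kernel1 eta) x = [set v | v \in C x].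
Proof.
apply/seteqP; split=> [w [q [<- [v /unit_form_kernel Cv <-]]] //|w Cw].
have [U [sg [oU Ux sb tb _]]] := unit_sheets x.
have [tx Sx] := tb true _ Ux.
pose q : Mt := SigSub (mem_set Sx).
have Eq : tau' q = x by rewrite -[RHS]tx.
exists q; split=> //; exists w; last exact: unit_tangent_proj.
by apply/unit_form_kernel; rewrite unit_tangent_proj Eq.
Qed.

Lemma unit_contact_form : contact_form_on setT eta.
Proof.
(* In the coordinates shared by [q] and its projection the form is [L] times a local contact form
   [f] of the base. This single package serves both smoothness and the contact condition. *)
have key q : exists (f : tensor_field M 1) (L : 'rV[R]_(n.*2.+1) -> R),
    [/\ (\forall z \near tau' q, multilinear (f z)),
        (forall v, Cinf_at (fun y => local_tensor f (tau' q) y v : R) (coord q)),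
        Cinf_at L (coord q),
        (\forall y \near coord q, forall v,
          local_tensor eta q y v = L y * local_tensor f (tau' q) y v)
      & [/\ L (coord q) != 0, forall u, eta q u = L (coord q) * f (tau' q) u
          & exists v, wedge (f (tau' q)) (wedge_exp (ext_deriv f (tau' q)) n) v != 0]].
  have [U [f [lam [[oU Up [[sf af] cf]] [Elam l0 sl]]]]] := local_contact_ratio hM hP (tau' q).
  have [cq Dq] := sheet_good sM st (sheets := unit_sheet) q.
  have fE y u : f y u = f y (fun=> u ord0).
    by congr (f y); apply/funext => i; rewrite (ord1 i).
  exists f, (fun y => lam (incl (cinv (chart_at q) y))); split.
  - apply: filterS (open_nbhs_nbhs (conj oU Up)) => y Uy.
    by have [] := sf y Uy.
  - by have [] := sf _ Up.
  - have sli : smooth_real (lam \o incl) q.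
      apply: (@smooth_at_comp _ _ _ _ Mt P (real_line R)
        (sheet_good sM st (sheets := unit_sheet)) gdP incl lam q (unit_incl_smooth q)).
      exact: sl.
    by have := (smooth_realP (sheet_good sM st (sheets := unit_sheet)) _ _).1 sli.
  - have oU' := near_cinv cq Dq (continuous_near_open
      (continuous_sheet_proj st (sheets := unit_sheet) (q := q)) oU Up).
    apply: filterS2 oU' (near_sheet_transition sM st (sheets := unit_sheet) q) => y Uy [Et T] v.
    set z := cinv (chart_at q) y in Uy Et *.
    rewrite /local_tensor -/z unit_formE (Elam (incl z) Uy).
    rewrite -Et fE; congr (_ * f _ _).
    by apply/funext => i; rewrite (ord1 i) Et; exact: T.
  - have EL : incl (cinv (chart_at q) (coord q)) = incl q.
      by congr incl; exact: (cinvK cq Dq).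
    rewrite /= EL; split; first exact: l0.
      by move=> u; rewrite unit_formE (Elam _ Up) (fE (tau' q) u).
    exact: cf.
split; first split.
- move=> q _; have [f [L [mf sf CL nE [L0 EL _]]]] := key q; split.
    apply/multilinear1P => c u w; rewrite !unit_formE.
    exact: Phi_linear.
  move=> v; apply: near_eq_Cinf_at (Cinf_atM CL (sf v)).
  by apply: filterS nE => y ->.
- by move=> q _ v i j; rewrite (ord1 i) (ord1 j) eqxx.
- move=> q _; have [f [L [mf sf CL nE [L0 EL nz]]]] := key q.
  apply: (wedge_contact_rescale (nbhs_singleton mf) _ L0 EL _ nz).
    exact: multilinear_ext_deriv1.
  move=> w kw; exact: (ext_deriv1_rescale (x' := q) sM _ sf CL nE kw).
Qed.

End DoubleCover.

Theorem proposition10p1 (R : realType) (n : nat)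
    (M : charted R n.*2.+1) (C : M -> {vspace 'rV[R]_(n.*2.+1)})
    (P : charted R n.*2.+2) (tau : P -> M) (h : R -> P -> P)
    (omega : tensor_field P 2) (gM : tensor_field M 2)
    (hM : contact_manifold C)
    (hP : symplectic_cover tau h C omega)
    (hg : riemannian gM) :
  exists s : P -> R,
    [/\ unique (metric_calibration tau h C omega gM) s,
        calibration h s
      & let S : set P := [set p | s p - 1 = 0] in
        exists ch : set_type S -> chart R (set_type S) n.*2.+1,
          let Mt := Charted ch in
          let incl : Mt -> P := set_val in
          let tau' : Mt -> M := tau \o incl in
          let eta := pullback incl (liouville h omega) in
          [/\ embedded_submanifold ch,
              two_sheeted_cover tau',
              contact_form_on setT eta,
              exists sigma : Mt -> Mt,
                [/\ forall q, incl (sigma q) = h (-1) (incl q),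
                    exists sigma', diffeo_on setT setT sigma sigma',
                    forall U V b, two_sheets tau' U V ->
                      sigma @` V b = V (~~ b)
                  & forall q v, pullback sigma eta q v = - eta q v]
            & (forall q v, kernel1 eta q v <-> tangent_map tau' q v \in C (tau' q)) /\
              forall x, tangent_image tau' (kernel1 eta) x = [set v | v \in C x]]].

Proof.
exists (metric_calib gM hM hP); split.
- split; first exact: metric_calib_metric.
  by move=> s; exact: metric_calib_unique.
- exact: metric_calib_calibration.
exists (unit_chart (hM := hM) (hP := hP) hg); split.
- exact: unit_embedded.
- exact: unit_two_sheeted_cover.
- exact: unit_contact_form.
- exists (@flip R n M C P tau h omega gM hM hP hg); split.
  + exact: flipE.
  + exists (@flip R n M C P tau h omega gM hM hP hg); split.
    * by move=> q _; exact: flip_smooth.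
    * by move=> q _; exact: flip_smooth.
    * by move=> q _; split=> //; exact: flipK.
    * by move=> q _; split=> //; exact: flipK.
  + by move=> U V b; exact: flip_sheets.
  + exact: unit_form_flip.
- by split=> [q v|x]; [exact: unit_form_kernel | exact: unit_form_image].
Qed.
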